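(* Let $M(E,I)$ be a locally finite-dimensional free partially commutative monoid, where $E$ is equipped with a total order $\leq$, and let $X$ be a right $M(E,I)$-set. Let $F: (M(E,I)/X)^{op} \rightarrow \mathrm{Ab}$ be a functor and let $\overline{F}: (\Box_+/Q_*X)^{op}\rightarrow \mathrm{Ab}$ be the corresponding homological system on the semicubical set $Q_*X$. Then $$\varinjlim\nolimits_n^{(M(E,I)/X)^{op}}F\cong H_n(Q_*X,\overline{F}) \quad\text{for all } n\geq 0.$$ In other words, the groups $\varinjlim_n^{(M(E,I)/X)^{op}}F$ are isomorphic to the homology groups of the chain complex $$0 \leftarrow \bigoplus_{x\in Q_0 X} F(x) \stackrel{d_1}\leftarrow \bigoplus_{(x,a_1)\in Q_1 X} F(x) \stackrel{d_2}\leftarrow \bigoplus_{(x, a_1, a_2)\in Q_2 X} F(x) \leftarrow \cdots \leftarrow \bigoplus_{(x, a_1, \ldots, a_{n-1})\in Q_{n-1}X} F(x) \stackrel{d_n}\longleftarrow \bigoplus_{(x, a_1, \ldots, a_n)\in Q_n X} F(x) \leftarrow \cdots,$$ where $$d_n(x,a_1, \ldots, a_n,f) = \sum_{s=1}^n(-1)^s \Big( (x\cdot a_s, a_1, \ldots, \widehat{a_s}, \ldots, a_n, F(x\stackrel{a_s}\rightarrow x\cdot a_s)(f)) - (x, a_1, \ldots, \widehat{a_s}, \ldots, a_n, f) \Big).$$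
   Context: For a set $E$ and an irreflexive symmetric relation $I\subseteq E\times E$ ($E$ possibly infinite), $M(E,I)$ is the monoid with generators $E$ and relations $ab=ba$ for all $(a,b)\in I$. Elements $a,b\in E$ with $(a,b)\in I$ are called commuting generators. $M(E,I)$ is locally finite-dimensional if every maximal subset of $E$ consisting of mutually commuting generators is finite; equivalently, the graph $(E,I)$ has no infinite clique. For a monoid $M$ and a right $M$-set $X$, the category $(M/X)^{op}$ has the elements $x\in X$ as objects; morphisms $x\to y$ are triples $x\stackrel{\mu}\rightarrow y$ with $\mu\in M$ and $x\cdot\mu=y$; composition: $x\stackrel{\mu_1}\to y$ followed by $y\stackrel{\mu_2}\to z$ is $x\stackrel{\mu_1\mu_2}\to z$. For a small category $\mathscr{C}$, $\varinjlim_n^{\mathscr{C}}:\mathrm{Ab}^{\mathscr{C}}\to\mathrm{Ab}$ denotes the $n$-th left derived functor of the colimit functor (equivalently, $n$-th homology of the complex $C_n(\mathscr{C},F)=\bigoplus_{c_0\to\cdots\to c_n}F(c_0)$ with the usual alternating-sum differential). $\Box_+$ is the category whose objects are the posets $\mathbb{I}^n=\{0,1\}^n$ ($n\ge 0$) and whose morphisms are compositions of the maps $\delta_i^{k,\varepsilon}:\mathbb{I}^{k-1}\to\mathbb{I}^k$, $\delta_i^{k,\varepsilon}(x_1,\ldots,x_{k-1})=(x_1,\ldots,x_{i-1},\varepsilon,x_i,\ldots,x_{k-1})$, $1\le i\le k$, $\varepsilon\in\{0,1\}$. A semicubical set is a functor $X:\Box_+^{op}\to\mathrm{Set}$, equivalently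 sets $X_n$ with maps $\partial_i^{n,\varepsilon}=X(\delta_i^{n,\varepsilon}):X_n\to X_{n-1}$ satisfying $\partial_i^{n-1,\alpha}\partial_j^{n,\beta}=\partial_{j-1}^{n-1,\beta}\partial_i^{n,\alpha}$ for $1\le i<j\le n$. The category $\Box_+/X$ has objects the elements of $\coprod_n X_n$; morphisms from $\sigma\in X_m$ to $\tau\in X_n$ are triples $(\alpha,\sigma,\tau)$ with $\alpha\in\Box_+(\mathbb{I}^m,\mathbb{I}^n)$, $X(\alpha)(\tau)=\sigma$. A homological system on $X$ is a functor $G:(\Box_+/X)^{op}\to\mathrm{Ab}$. $H_n(X,G)$ is the $n$-th homology group of the complex $C_n(X,G)=\bigoplus_{\sigma\in X_n}G(\sigma)$ with differential $d_n=\sum_{i=1}^n(-1)^i(d_i^{n,1}-d_i^{n,0})$, where $d_i^{n,\varepsilon}$ maps the summand $G(\sigma)$ to the summand $G(\partial_i^{n,\varepsilon}\sigma)$ by $G(\delta_i^{n,\varepsilon},\partial_i^{n,\varepsilon}(\sigma),\sigma)$. For a right $M(E,I)$-set $X$ and a total order on $E$, $Q_*X$ is the semicubical set with $Q_nX=\{(x,a_1,\ldots,a_n): x\in X,\ a_i\in E,\ a_1<\cdots<a_n,\ (a_i,a_j)\in I \text{ for } 1\le i<j\le n\}$ (so $Q_0X=X$) and $\partial_i^{n,\varepsilon}(x,a_1,\ldots,a_n)=(x\cdot a_i^{\varepsilon},a_1,\ldots,\widehat{a_i},\ldots,a_n)$, where $a_i^0=1$, $a_i^1=a_i$. For $F:(M(E,I)/X)^{op}\to\mathrm{Ab}$,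 the homological system $\overline F$ on $Q_*X$ is given by $\overline F(x,a_1,\ldots,a_n)=F(x)$ and $\overline F(\delta_i^{n,\varepsilon},\partial_i^{n,\varepsilon}(\sigma),\sigma)=F(x\stackrel{a_i^\varepsilon}\to x\cdot a_i^\varepsilon)$ for $\sigma=(x,a_1,\ldots,a_n)$. Elements of a direct sum $\bigoplus_j A_j$ lying in a summand are written as $(j,g)$ with $g\in A_j$. *)

(* Defs.v *)
From HB Require Import structures.
From mathcomp Require Import all_boot all_order all_algebra.
From mathcomp Require Import finmap mathcomp_extra boolp classical_sets.
From mathcomp Require Import functions cardinality fsbigop.

Set Implicit Arguments.
Unset Strict Implicit.
Unset Printing Implicit Defensive.

Import Order.TTheory GRing.Theory.

Local Open Scope classical_set_scope.
Local Open Scope quotient_scope.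
Local Open Scope ring_scope.

Definition mk_additive (A B : zmodType) (f : A -> B) (fB : zmod_morphism f) :
    {additive A -> B} :=
  HB.pack f (GRing.isZmodMorphism.Build A B f fB).

Definition zmod_iso (A B : zmodType) : Prop :=
  exists f : {additive A -> B}, bijective f.

Section DirectSum.
Variables (J : Type) (A : J -> zmodType).

Record dsum := DSum {
  dsum_val :> forall j, A j;
  dsum_fin : finite_set [set j | dsum_val j != 0] }.

Lemma dsumP (u v : dsum) : (forall j, u j = v j) -> u = v.
Proof.
case: u v => [u uf] [v vf] /= uv; have {}uv := functional_extensionality_dep uv.
by subst v; congr DSum.
Qed.

HB.instance Definition _ := gen_eqMixin dsum.
HB.instance Definition _ := gen_choiceMixin dsum.

Lemma dsum_zero_fin : finite_set [set j | (0 : A j) != 0].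
Proof.
by apply: (sub_finite_set _ (finite_set0 _)) => j /=; rewrite eqxx.
Qed.
Definition dsum_zero := DSum dsum_zero_fin.

Lemma dsum_opp_fin (u : dsum) : finite_set [set j | - u j != 0].
Proof.
by apply: sub_finite_set (dsum_fin u) => j /=; rewrite oppr_eq0.
Qed.
Definition dsum_opp u := DSum (dsum_opp_fin u).

Lemma dsum_add_fin (u v : dsum) : finite_set [set j | u j + v j != 0].
Proof.
apply: (@sub_finite_set _ _ ([set j | u j != 0] `|` [set j | v j != 0])).
  move=> j /=; have [->|] := eqVneq (u j) 0; last by left.
  by rewrite add0r; right.
by rewrite finite_setU; split; exact: dsum_fin.
Qed.
Definition dsum_add u v := DSum (dsum_add_fin u v).

Lemma dsum_addA : associative dsum_add.
Proof. by move=> u v w; apply: dsumP => j /=; rewrite addrA. Qed.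
Lemma dsum_addC : commutative dsum_add.
Proof. by move=> u v; apply: dsumP => j /=; rewrite addrC. Qed.
Lemma dsum_add0 : left_id dsum_zero dsum_add.
Proof. by move=> u; apply: dsumP => j /=; rewrite add0r. Qed.
Lemma dsum_addN : left_inverse dsum_zero dsum_opp dsum_add.
Proof. by move=> u; apply: dsumP => j /=; rewrite addNr. Qed.

HB.instance Definition _ :=
  GRing.isZmodule.Build dsum dsum_addA dsum_addC dsum_add0 dsum_addN.

Definition dinj_fun j (g : A j) : forall k, A k :=
  fun k => if pselect (j = k) is left e then ecast k (A k) e g else 0.

Lemma dinj_id j (g : A j) : dinj_fun g j = g.
Proof.
by rewrite /dinj_fun; case: pselect => // e; rewrite (Prop_irrelevance e erefl).
Qed.

Lemma dinj_neq j (g : A j) k : j <> k -> dinj_fun g k = 0.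
Proof. by rewrite /dinj_fun; case: pselect. Qed.

Lemma dinj_fin j (g : A j) : finite_set [set k | dinj_fun g k != 0].
Proof.
apply: (sub_finite_set _ (finite_set1 j)) => k /=; apply: contra_neqP => /nesym.
exact: dinj_neq.
Qed.

(* the element written (j, g) *)
Definition dinj j (g : A j) : dsum := DSum (dinj_fin g).

Lemma dinj_is_additive j : zmod_morphism (@dinj j).
Proof.
move=> g h; apply: dsumP => k /=.
have [<-|jk] := pselect (j = k); first by rewrite !dinj_id.
by rewrite !dinj_neq // subr0.
Qed.
HB.instance Definition _ j :=
  GRing.isZmodMorphism.Build _ _ (@dinj j) (@dinj_is_additive j).

Lemma dsum_eval_is_additive j : zmod_morphism (fun u : dsum => u j).
Proof. by []. Qed.
Definition dsum_eval j : {additive dsum -> A j} :=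
  mk_additive (@dsum_eval_is_additive j).

Lemma dsum_ind (P : dsum -> Prop) :
  P 0 -> (forall j g, P (@dinj j g)) -> (forall u v, P u -> P v -> P (u + v)) ->
  forall u, P u.
Proof.
move=> P0 Pinj PD u.
pose s : seq {classic J} := fset_set ([set j | u j != 0] : set {classic J}).
have us j : j \notin s -> u j = 0.
  move=> js; apply/eqP; apply: contraNT js => uj.
  by rewrite /s in_fset_set ?mem_set //; exact: dsum_fin.
have -> : u = \sum_(j <- s) dinj (u j).
  apply: dsumP => k.
  rewrite -[RHS]/(dsum_eval k _) raddf_sum /=.
  have [ks|ks] := boolP ((k : {classic J}) \in s); last first.
    rewrite us // big1_seq // => j /andP[_ js] /=.
    by rewrite dinj_neq // => jk; rewrite -jk js in ks.
  rewrite (bigD1_seq (k : {classic J})) ?fset_uniq //= dinj_id big1 ?addr0 //.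
  by move=> j jk; rewrite dinj_neq // => e; rewrite e eqxx in jk.
elim: s {us} => [|j s IH]; first by rewrite big_nil.
by rewrite big_cons; apply: PD.
Qed.

Section Elim.
Variables (B : zmodType) (f : forall j, {additive A j -> B}).

Definition dsum_elim (u : dsum) : B :=
  \sum_(j \in [set: {classic J}]) f j (u j).

Lemma dsum_elimE (s : {fset {classic J}}) (u : dsum) :
  (forall j : {classic J}, j \notin s -> u j = 0) ->
  dsum_elim u = \sum_(j <- s) f j (u j).
Proof.
move=> us; rewrite /dsum_elim.
rewrite -(@fsbig_widen _ _ _ _ [set` s] setT) //; last first.
  by move=> j [_ /= /negP js]; rewrite us // raddf0.
by rewrite -fsbig_seq //; exact: fset_uniq.
Qed.

Lemma dsum_elim_is_additive : zmod_morphism dsum_elim.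
Proof.
move=> u v.
pose D : set {classic J} := [set j | u j != 0] `|` [set j | v j != 0].
have finD : finite_set D by rewrite finite_setU; split; exact: dsum_fin.
pose s : {fset {classic J}} := fset_set D.
have sP (j : {classic J}) : j \notin s -> u j = 0 /\ v j = 0.
  move=> js; split; apply/eqP; apply: contraNT js => uj;
    by rewrite /s in_fset_set // mem_set //; do ?[by left|by right].
rewrite !(@dsum_elimE s) => [|j /sP[]//|j /sP[]//|j /sP[/= -> ->]]; last first.
  by rewrite subr0.
by rewrite -sumrB; apply: eq_bigr => j _; rewrite raddfB.
Qed.
HB.instance Definition _ :=
  GRing.isZmodMorphism.Build _ _ dsum_elim dsum_elim_is_additive.

Lemma dsum_elim_inj j g : dsum_elim (@dinj j g) = f j g.
Proof.
rewrite (@dsum_elimE [fset (j : {classic J})]%fset).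
  by rewrite big_seq_fset1 /= dinj_id.
by move=> k; rewrite inE => /eqP kj /=; rewrite dinj_neq // => e; apply: kj.
Qed.

End Elim.

Lemma dsum_additive_eq (B : zmodType) (h k : {additive dsum -> B}) :
  (forall j g, h (@dinj j g) = k (dinj g)) -> h =1 k.
Proof.
move=> hk; apply: dsum_ind => [|//|u v hu hv]; first by rewrite !raddf0.
by rewrite !raddfD hu hv.
Qed.

End DirectSum.

Section Cokernel.
Variables (A B : zmodType) (f : {additive A -> B}).

Definition image_pred : {pred B} := fun b => `[< exists a, f a = b >].

Lemma image_pred_closed : zmod_closed image_pred.
Proof.
split=> [|x y]; first by apply/asboolP; exists 0; rewrite raddf0.
move=> /asboolP[a <-] /asboolP[b <-]; apply/asboolP; exists (a - b).
by rewrite raddfB.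
Qed.
HB.instance Definition _ := GRing.isZmodClosed.Build B image_pred image_pred_closed.

Definition coker : zmodType := Quotient.quot image_pred.

Definition coker_pi (b : B) : coker := \pi_(Quotient.quot image_pred) b.

Lemma coker_pi_is_additive : zmod_morphism coker_pi.
Proof. by move=> x y; rewrite /coker_pi raddfB. Qed.
HB.instance Definition _ :=
  GRing.isZmodMorphism.Build B coker coker_pi coker_pi_is_additive.

Lemma coker_pi_surj (q : coker) : exists b, coker_pi b = q.
Proof. by exists (repr q); rewrite /coker_pi reprK. Qed.

Lemma coker_piP (x y : B) :
  coker_pi x = coker_pi y <-> exists a, f a = x - y.
Proof.
split.
  by move/eqP; rewrite -Quotient.idealrBE => /asboolP.
by move=> xy; apply/eqP; rewrite -Quotient.idealrBE; apply/asboolP.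
Qed.

End Cokernel.

Section CokernelMap.
Variables (A B A' B' : zmodType).
Variables (f : {additive A -> B}) (f' : {additive A' -> B'}).
Variable (h : {additive B -> B'}).
Hypothesis hf : forall a, exists a', f' a' = h (f a).

Definition coker_map_fun (q : coker f) : coker f' :=
  coker_pi f' (h (repr (q : Quotient.quot (image_pred f)))).

Lemma coker_map_funE b : coker_map_fun (coker_pi f b) = coker_pi f' (h b).
Proof.
apply/coker_piP; rewrite -raddfB.
have /coker_piP[a <-] : coker_pi f (repr (coker_pi f b : Quotient.quot (image_pred f))) =
    coker_pi f b by rewrite /coker_pi reprK.
exact: hf.
Qed.

Lemma coker_map_is_additive : zmod_morphism coker_map_fun.
Proof.
move=> q r; have [x <-] := coker_pi_surj q; have [y <-] := coker_pi_surj r.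
by rewrite -raddfB !coker_map_funE !raddfB.
Qed.

Definition coker_map : {additive coker f -> coker f'} :=
  mk_additive coker_map_is_additive.

End CokernelMap.

Record chain_complex := ChainComplex {
  ch :> nat -> zmodType;
  bd : forall n, {additive ch n.+1 -> ch n};
  bd_bd : forall n x, bd n (bd n.+1 x) = 0 }.

Section Homology.
Variables (C : chain_complex) (n : nat).

Definition is_cycle : {pred C n} :=
  match n return C n -> bool with
  | 0 => fun _ => true
  | k.+1 => fun x => bd C k x == 0
  end.

Lemma is_cycle_closed : zmod_closed is_cycle.
Proof.
rewrite /is_cycle; case: n => [|k]; first by split.
by split=> [|x y]; rewrite !unfold_in ?raddf0 // raddfB => /eqP-> /eqP->; rewrite subrr.
Qed.
HB.instance Definition _ := GRing.isZmodClosed.Build _ is_cycle is_cycle_closed.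

Record cycle := Cycle { cycle_val : C n; cycleP : cycle_val \in is_cycle }.
HB.instance Definition _ := [isSub for cycle_val].
HB.instance Definition _ := [Choice of cycle by <:].
HB.instance Definition _ := [SubChoice_isSubZmodule of cycle by <:].

Lemma bd_is_cycle (x : C n.+1) : bd C n x \in is_cycle.
Proof.
move: x; rewrite /is_cycle; case: n => [//|k] x.
by rewrite unfold_in bd_bd.
Qed.

Definition bd_cycle (x : C n.+1) : cycle := Cycle (bd_is_cycle x).

Lemma bd_cycle_is_additive : zmod_morphism bd_cycle.
Proof. by move=> x y; apply: val_inj; rewrite /= raddfB. Qed.
HB.instance Definition _ :=
  GRing.isZmodMorphism.Build _ _ bd_cycle bd_cycle_is_additive.

Definition homology : zmodType := coker bd_cycle.

End Homology.

Record category := Category {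
  ob :> Type;
  hom : ob -> ob -> Type;
  idm : forall a, hom a a;
  (* diagrammatic order: [comp f g] is f followed by g *)
  comp : forall a b c, hom a b -> hom b c -> hom a c;
  comp1m : forall a b (f : hom a b), comp (idm a) f = f;
  compm1 : forall a b (f : hom a b), comp f (idm b) = f;
  compmA : forall a b c d (f : hom a b) (g : hom b c) (h : hom c d),
    comp f (comp g h) = comp (comp f g) h }.

Definition opcat (C : category) : category :=
  @Category C (fun a b => @hom C b a) (@idm C) (fun _ _ _ f g => comp g f)
    (fun _ _ f => compm1 f) (fun _ _ f => comp1m f)
    (fun _ _ _ _ f g h => esym (compmA h g f)).

Record set_functor (C : category) := SetFunctor {
  sfob :> C -> Type;
  sfmap : forall a b, hom a b -> sfob a -> sfob b;
  sfmap1 : forall a x, sfmap (idm a) x = x;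
  sfmapM : forall a b c (f : hom a b) (g : hom b c) x,
    sfmap (comp f g) x = sfmap g (sfmap f x) }.

Record ab_functor (C : category) := AbFunctor {
  afob :> C -> zmodType;
  afmap : forall a b, hom a b -> {additive afob a -> afob b};
  afmap1 : forall a x, afmap (idm a) x = x;
  afmapM : forall a b c (f : hom a b) (g : hom b c) x,
    afmap (comp f g) x = afmap g (afmap f x) }.
Arguments afmap {C} F {a b} f : rename.

Record nat_trans (C : category) (F G : ab_functor C) := NatTrans {
  nt_val :> forall c, {additive F c -> G c};
  nt_nat : forall a b (f : hom a b) x,
    nt_val b (afmap F f x) = afmap G f (nt_val a x) }.

Section Colimit.
Variable C : category.

Definition arrow := {ab : C * C & hom ab.1 ab.2}.

Definition colim_rel_fun (F : ab_functor C) (p : arrow) (x : F (projT1 p).1) :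
    dsum F :=
  @dinj _ F (projT1 p).1 x - @dinj _ F (projT1 p).2 (afmap F (projT2 p) x).

Lemma colim_rel_is_additive F p : zmod_morphism (@colim_rel_fun F p).
Proof. by move=> x y; rewrite /colim_rel_fun !raddfB /= addrACA. Qed.

Definition colim_rel (F : ab_functor C) :
    {additive dsum (fun p : arrow => F (projT1 p).1) -> dsum F} :=
  dsum_elim (fun p => mk_additive (@colim_rel_is_additive F p)).

Lemma colim_rel_inj F p x :
  colim_rel F (@dinj _ (fun p : arrow => F (projT1 p).1) p x) =
  colim_rel_fun x.
Proof. exact: dsum_elim_inj. Qed.

Definition colim (F : ab_functor C) : zmodType := coker (colim_rel F).

Section Map.
Variables (F G : ab_functor C) (eta : nat_trans F G).

Definition dsum_nt : {additive dsum F -> dsum G} :=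
  dsum_elim (fun c => (@dinj _ G c \o eta c : {additive F c -> dsum G})).

Lemma dsum_nt_inj c x : dsum_nt (@dinj _ F c x) = @dinj _ G c (eta c x).
Proof. exact: dsum_elim_inj. Qed.

Lemma dsum_nt_rel u : exists v, colim_rel G v = dsum_nt (colim_rel F u).
Proof.
elim/dsum_ind: u => [|p x|u v [u' eu] [v' ev]].
- by exists 0; rewrite !raddf0.
- exists (dinj (A := fun p : arrow => G (projT1 p).1) (eta _ x : G (projT1 p).1)).
  by rewrite !colim_rel_inj /colim_rel_fun raddfB !dsum_nt_inj nt_nat.
- by exists (u' + v'); rewrite !raddfD /= eu ev.
Qed.

Definition colim_map : {additive colim F -> colim G} := coker_map dsum_nt_rel.

Lemma colim_mapE u : colim_map (coker_pi _ u) = coker_pi _ (dsum_nt u).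
Proof. exact: coker_map_funE dsum_nt_rel u. Qed.

End Map.

(* epimorphisms and exactness in Ab^C are objectwise *)
Definition projective (P : ab_functor C) : Prop :=
  forall (G H : ab_functor C) (eta : nat_trans G H),
    (forall c y, exists x, eta c x = y) ->
  forall phi : nat_trans P H,
    exists psi : nat_trans P G, forall c x, eta c (psi c x) = phi c x.

Record projective_resolution (F : ab_functor C) := ProjectiveResolution {
  pr :> nat -> ab_functor C;
  pr_bd : forall n, nat_trans (pr n.+1) (pr n);
  pr_aug : nat_trans (pr 0) F;
  pr_projective : forall n, projective (pr n);
  pr_aug_surj : forall c y, exists x, pr_aug c x = y;
  pr_exact0 : forall c x, pr_aug c x = 0 <-> exists y, pr_bd 0 c y = x;
  pr_exactS : forall n c x,
    pr_bd n c x = 0 <-> exists y, pr_bd n.+1 c y = x }.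

Section DerivedColimit.
Variables (F : ab_functor C) (P : projective_resolution F).

Lemma colim_pr_bd_bd n (x : colim (P n.+2)) :
  colim_map (pr_bd P n) (colim_map (pr_bd P n.+1) x) = 0.
Proof.
have [u <-] := coker_pi_surj x.
rewrite !colim_mapE.
suff -> : dsum_nt (pr_bd P n) (dsum_nt (pr_bd P n.+1) u) = 0 by rewrite raddf0.
elim/dsum_ind: u => [|c y|u v eu ev]; first by rewrite !raddf0.
  rewrite !dsum_nt_inj.
  suff -> : pr_bd P n c (pr_bd P n.+1 c y) = 0 by rewrite raddf0.
  by apply/pr_exactS; exists y.
by rewrite !raddfD /= eu ev addr0.
Qed.

Definition colim_complex : chain_complex :=
  ChainComplex colim_pr_bd_bd.

(* the value at F of the n-th left derived functor of the colimit functor,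
   computed with the projective resolution P of F *)
Definition derived_colim (n : nat) : zmodType := homology colim_complex n.

End DerivedColimit.
End Colimit.

(* Ab^C has enough projectives, so projective resolutions exist. *)
Section Resolutions.
Variable C : category.

Definition zmul (A : zmodType) (x : A) (z : int) : A := x *~ z.

Lemma zmul_is_additive (A : zmodType) (x : A) : zmod_morphism (zmul x).
Proof. by move=> m n; rewrite /zmul mulrzBr. Qed.
HB.instance Definition _ (A : zmodType) (x : A) :=
  GRing.isZmodMorphism.Build int A (zmul x) (zmul_is_additive x).

Lemma raddf_zmul (A B : zmodType) (f : {additive A -> B}) x z :
  f (zmul x z) = zmul (f x) z.
Proof. exact: raddfMz. Qed.

Section FreeCover.
Variable F : ab_functor C.

Definition fgen (c : C) : Type := {d : C & (F d * hom d c)%type}.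

Definition fpush a b (f : hom a b) (p : fgen a) : fgen b :=
  existT _ (projT1 p) ((projT2 p).1, comp (projT2 p).2 f).

Lemma fpush1 a p : fpush (idm a) p = p.
Proof. by case: p => d [x f]; rewrite /fpush /= compm1. Qed.

Lemma fpushM a b c (f : hom a b) (g : hom b c) p :
  fpush (comp f g) p = fpush g (fpush f p).
Proof. by rewrite /fpush /= compmA. Qed.

Definition free_ob (c : C) : zmodType := dsum (fun _ : fgen c => int : zmodType).

Definition fbase c (p : fgen c) : {additive int -> free_ob c} :=
  mk_additive (@dinj_is_additive _ (fun _ : fgen c => int : zmodType) p).

Lemma free_ob_eq c (B : zmodType) (h k : {additive free_ob c -> B}) :
  (forall p z, h (fbase p z) = k (fbase p z)) -> h =1 k.
Proof. by move=> hk; apply: dsum_additive_eq => p z; exact: hk. Qed.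

Definition free_map a b (f : hom a b) : {additive free_ob a -> free_ob b} :=
  dsum_elim (fun p => fbase (fpush f p)).

Lemma free_mapE a b (f : hom a b) p z :
  free_map f (fbase p z) = fbase (fpush f p) z.
Proof. exact: dsum_elim_inj. Qed.

Lemma free_map1 a x : free_map (idm a) x = x.
Proof.
apply: (free_ob_eq (k := idfun)) => p z.
by rewrite free_mapE fpush1.
Qed.

Lemma free_mapM a b c (f : hom a b) (g : hom b c) x :
  free_map (comp f g) x = free_map g (free_map f x).
Proof.
apply: (free_ob_eq (k := (free_map g \o free_map f))) => p z.
by rewrite /= !free_mapE fpushM.
Qed.

Definition free_cover : ab_functor C := AbFunctor free_map1 free_mapM.

Section Universal.
Variables (G : ab_functor C) (s : forall d, F d -> G d).

Definition free_lift_fun c : {additive free_ob c -> G c} :=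
  dsum_elim (fun p : fgen c =>
    (zmul (afmap G (projT2 p).2 (s (projT2 p).1)) : {additive int -> G c})).

Lemma free_liftE c p z : @free_lift_fun c (fbase p z) =
  zmul (afmap G (projT2 p).2 (s (projT2 p).1)) z.
Proof. exact: dsum_elim_inj. Qed.

Lemma free_lift_nat a b (f : hom a b) x :
  free_lift_fun b (free_map f x) = afmap G f (free_lift_fun a x).
Proof.
apply: (free_ob_eq (h := (free_lift_fun b \o free_map f))
  (k := (afmap G f \o free_lift_fun a))) => p z.
rewrite -[LHS]/(free_lift_fun b (free_map f (fbase p z))) free_mapE.
rewrite -[RHS]/(afmap G f (free_lift_fun a (fbase p z))) !free_liftE.
by rewrite raddf_zmul afmapM.
Qed.

Definition free_lift : nat_trans free_cover G := @NatTrans C free_cover G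
  free_lift_fun free_lift_nat.

End Universal.

Definition free_aug : nat_trans free_cover F := free_lift (fun d => id).

Lemma free_aug_surj c y : exists x, free_aug c x = y.
Proof.
exists (fbase (existT _ c (y, idm c)) 1).
by rewrite [LHS]free_liftE afmap1.
Qed.

Lemma free_cover_projective : projective free_cover.
Proof.
move=> G H eta eta_surj phi.
pose g d (x : F d) : free_ob d := fbase (existT _ d (x, idm d)) 1.
pose s d (x : F d) : G d := sval (cid (eta_surj d (phi d (g d x)))).
have sE d x : eta d (s d x) = phi d (g d x) by rewrite /s; case: cid.
exists (free_lift s) => c x.
apply: (free_ob_eq (h := (eta c \o free_lift s c)) (k := phi c)) => p z.
rewrite -[LHS]/(eta c (free_lift_fun s c (fbase p z))) free_liftE.
rewrite raddf_zmul nt_nat sE -nt_nat.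
rewrite [afmap _ _ _]free_mapE -raddf_zmul -raddf_zmul; congr (phi c (fbase _ _)).
  by case: p => d [y f]; rewrite /fpush /= comp1m.
by rewrite /zmul intz.
Qed.

End FreeCover.

Section Kernel.
Variables (A B : zmodType) (f : {additive A -> B}).

Definition ker_pred : {pred A} := fun x => f x == 0.

Lemma ker_pred_closed : zmod_closed ker_pred.
Proof.
by split=> [|x y]; rewrite !unfold_in ?raddf0 // raddfB => /eqP-> /eqP->;
  rewrite subrr.
Qed.
HB.instance Definition _ := GRing.isZmodClosed.Build A ker_pred ker_pred_closed.

Record kernel := Kernel { kernel_val : A; kernelP : kernel_val \in ker_pred }.
HB.instance Definition _ := [isSub for kernel_val].
HB.instance Definition _ := [Choice of kernel by <:].
HB.instance Definition _ := [SubChoice_isSubZmodule of kernel by <:].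

Lemma kernel0 (x : kernel) : f (kernel_val x) = 0.
Proof. by apply/eqP; exact: kernelP. Qed.

Lemma kernel_val_is_additive : zmod_morphism kernel_val.
Proof. by []. Qed.

End Kernel.

Section KernelFunctor.
Variables (F G : ab_functor C) (eta : nat_trans F G).

Lemma ker_map_subproof a b (f : hom a b) (x : kernel (eta a)) :
  afmap F f (kernel_val x) \in ker_pred (eta b).
Proof. by rewrite unfold_in nt_nat kernel0 raddf0. Qed.

Definition ker_map_fun a b (f : hom a b) (x : kernel (eta a)) :
  kernel (eta b) := Kernel (ker_map_subproof f x).

Lemma ker_map_is_additive a b (f : hom a b) : zmod_morphism (ker_map_fun f).
Proof. by move=> x y; apply: val_inj; rewrite /= raddfB. Qed.

Lemma ker_map1 a x : mk_additive (ker_map_is_additive (idm a)) x = x.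
Proof. by apply: val_inj; rewrite /= afmap1. Qed.

Lemma ker_mapM a b c (f : hom a b) (g : hom b c) x :
  mk_additive (ker_map_is_additive (comp f g)) x =
  mk_additive (ker_map_is_additive g) (mk_additive (ker_map_is_additive f) x).
Proof. by apply: val_inj; rewrite /= afmapM. Qed.

Definition ker_functor : ab_functor C :=
  @AbFunctor C (fun c => kernel (eta c) : zmodType) _ ker_map1 ker_mapM.

Definition ker_incl : nat_trans ker_functor F :=
  @NatTrans C ker_functor F
    (fun c => mk_additive (@kernel_val_is_additive _ _ (eta c)))
    (fun _ _ _ _ => erefl).

End KernelFunctor.

Section NatComp.
Variables (F G H : ab_functor C) (eta : nat_trans F G) (theta : nat_trans G H).

Lemma nt_comp_nat a b (f : hom a b) x :
  theta b (eta b (afmap F f x)) = afmap H f (theta a (eta a x)).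
Proof. by rewrite !nt_nat. Qed.

Definition nt_comp : nat_trans F H :=
  @NatTrans C F H (fun c => (theta c \o eta c : {additive F c -> H c}))
    nt_comp_nat.

End NatComp.

Variable F : ab_functor C.

Fixpoint syzygy (n : nat) : ab_functor C :=
  if n is k.+1 then ker_functor (free_aug (syzygy k)) else F.

Definition free_res (n : nat) : ab_functor C := free_cover (syzygy n).

Definition free_res_bd (n : nat) : nat_trans (free_res n.+1) (free_res n) :=
  nt_comp (free_aug (syzygy n.+1)) (ker_incl (free_aug (syzygy n))).

Lemma free_res_exact n c x : free_aug (syzygy n) c x = 0 <->
  exists y, free_res_bd n c y = x.
Proof.
split=> [x0|[y <-]]; last by rewrite /= kernel0.
have kx : x \in ker_pred (free_aug (syzygy n) c) by rewrite unfold_in x0.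
have [y ey] := @free_aug_surj (syzygy n.+1) c (Kernel kx).
by exists y; rewrite [LHS]/= ey.
Qed.

Lemma free_res_exactS n c x : free_res_bd n c x = 0 <->
  exists y, free_res_bd n.+1 c y = x.
Proof.
rewrite -free_res_exact; split => [x0|x0].
  by apply: val_inj; exact: x0.
by rewrite [LHS]/= x0.
Qed.

Definition free_resolution : projective_resolution F :=
  @ProjectiveResolution C F free_res free_res_bd (free_aug F)
    (fun n => @free_cover_projective (syzygy n)) (@free_aug_surj F)
    (@free_res_exact 0) free_res_exactS.

End Resolutions.

Section Insertion.
Variable T : Type.
Implicit Types s : seq T.

Definition ins i (e : T) s := take i s ++ e :: drop i s.

Lemma size_ins i e s : size (ins i e s) = (size s).+1.
Proof. by rewrite size_cat /= addnS -size_cat cat_take_drop. Qed.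

Lemma ins_ins i k e e' s : (i <= k <= size s)%N ->
  ins k.+1 e (ins i e' s) = ins i e' (ins k e s).
Proof.
elim: s i k => [|x s IH] i k; first by case: i k => [|i] [|k] //; rewrite andbF.
case: i k => [|i] [|k] // ik; try by rewrite /ins /= ?take0 ?drop0.
by have := IH i k ik; rewrite /ins /= => ->.
Qed.

Definition del i s := take i s ++ drop i.+1 s.

Lemma size_del i s : (i < size s)%N -> size (del i s) = (size s).-1.
Proof.
move=> ltis; rewrite size_cat size_takel 1?ltnW // size_drop.
by rewrite subnS -subn1 addnBA ?subn_gt0 // subnKC ?subn1 // ltnW.
Qed.

Lemma del_mask i s : exists m, del i s = mask m s.
Proof.
elim: s i => [|x s IH] i; first by exists [::]; case: i.
case: i => [|i]; last by have [m em] := IH i; exists (true :: m); rewrite /= -em.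
by exists (false :: nseq (size s) true); rewrite /del /= ?take0 ?drop0 mask_true.
Qed.

End Insertion.

Definition cube (n : nat) := n.-tuple bool.

Lemma delta_subproof n i (e : bool) (x : cube n) : size (ins i e x) == n.+1.
Proof. by rewrite size_ins size_tuple. Qed.

(* Coordinates are numbered from 0. *)
Definition delta n (i : 'I_n.+1) (e : bool) (x : cube n) : cube n.+1 :=
  Tuple (delta_subproof i e x).

Inductive is_face (m : nat) : forall n, (cube m -> cube n) -> Prop :=
| is_face_id : is_face (fun x : cube m => x)
| is_face_delta n (f : cube m -> cube n) (i : 'I_n.+1) (e : bool) :
    is_face f -> is_face (fun x => delta i e (f x)).

Lemma is_face_comp m n p (f : cube m -> cube n) (g : cube n -> cube p) :
  is_face f -> is_face g -> is_face (fun x => g (f x)).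
Proof. by move=> fP; elim=> //= q h i e _; exact: is_face_delta. Qed.

Definition face m n := {f : cube m -> cube n | is_face f}.

Lemma face_eq m n (f g : face m n) : sval f =1 sval g -> f = g.
Proof.
case: f g => [f fP] [g gP] /= fg; have {}fg : f = g by apply/funext.
by subst g; congr exist.
Qed.

Definition face_id n : face n n := exist _ _ (is_face_id n).

Definition face_comp m n p (f : face m n) (g : face n p) : face m p :=
  exist _ _ (is_face_comp (svalP f) (svalP g)).

Lemma face_comp1m m n (f : face m n) : face_comp (face_id m) f = f.
Proof. exact: face_eq. Qed.

Lemma face_compm1 m n (f : face m n) : face_comp f (face_id n) = f.
Proof. exact: face_eq. Qed.

Lemma face_compA m n p q (f : face m n) (g : face n p) (h : face p q) :
  face_comp f (face_comp g h) = face_comp (face_comp f g) h.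
Proof. exact: face_eq. Qed.

(* the category Box_+, the object n standing for the poset {0,1}^n *)
Definition box : category :=
  @Category nat face face_id face_comp face_comp1m face_compm1 face_compA.

Definition bdelta n (i : 'I_n.+1) (e : bool) : @hom box n n.+1 :=
  exist _ (delta i e) (is_face_delta i e (is_face_id n)).

Lemma bdelta_bdelta n (i k : 'I_n.+1) (e e' : bool) : (i <= k)%N ->
  comp (bdelta i e') (bdelta (lift ord0 k) e) =
  comp (bdelta k e) (bdelta (widen_ord (leqnSn _) i) e').
Proof.
move=> ik; apply: face_eq => x; apply: val_inj => /=.
by rewrite ins_ins // ik size_tuple -ltnS ltn_ord.
Qed.

Definition semicubical_set := set_functor (opcat box).

Definition sc_map (X : semicubical_set) m n (f : @hom box m n) : X n -> X m :=
  @sfmap (opcat box) X n m f.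
Arguments sc_map X {m n} f.

Definition sc_face (X : semicubical_set) n (i : 'I_n.+1) (e : bool) :
    X n.+1 -> X n := sc_map X (bdelta i e).

Section BoxOver.
Variable X : semicubical_set.

Definition cell := {n : nat & X n}.

Definition cell_hom (s t : cell) :=
  {f : @hom box (projT1 s) (projT1 t) | sc_map X f (projT2 t) = projT2 s}.

Lemma cell_hom_eq s t (f g : cell_hom s t) : sval f = sval g -> f = g.
Proof. by case: f g => [f fP] [g gP] /= fg; subst g; congr exist. Qed.

Lemma cell_id_subproof s : sc_map X (idm (projT1 s : box)) (projT2 s) = projT2 s.
Proof. exact: sfmap1. Qed.

Definition cell_id s : cell_hom s s := exist _ _ (cell_id_subproof s).

Lemma cell_comp_subproof s t u (f : cell_hom s t) (g : cell_hom t u) :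
  sc_map X (comp (sval f) (sval g)) (projT2 u) = projT2 s.
Proof.
case: f g => [f fP] [g gP] /=.
by rewrite /sc_map (@sfmapM (opcat box)) -/(sc_map X g _) gP.
Qed.

Definition cell_comp s t u (f : cell_hom s t) (g : cell_hom t u) :
  cell_hom s u := exist _ _ (cell_comp_subproof f g).

Lemma cell_comp1m s t (f : cell_hom s t) : cell_comp (cell_id s) f = f.
Proof. by apply: cell_hom_eq; exact: comp1m. Qed.

Lemma cell_compm1 s t (f : cell_hom s t) : cell_comp f (cell_id t) = f.
Proof. by apply: cell_hom_eq; exact: compm1. Qed.

Lemma cell_compA s t u v (f : cell_hom s t) (g : cell_hom t u)
    (h : cell_hom u v) :
  cell_comp f (cell_comp g h) = cell_comp (cell_comp f g) h.
Proof. by apply: cell_hom_eq; exact: compmA. Qed.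

Definition box_over : category :=
  @Category cell cell_hom cell_id cell_comp cell_comp1m cell_compm1 cell_compA.

Definition homological_system := ab_functor (opcat box_over).

End BoxOver.

Lemma alternating_sum0 (A : zmodType) n (T : 'I_n.+2 -> 'I_n.+1 -> A) :
  (forall i k : 'I_n.+1, (i <= k)%N ->
     T (lift ord0 k) i = T (widen_ord (leqnSn _) i) k) ->
  \sum_(j < n.+2) \sum_(i < n.+1) T j i *~ (-1) ^+ (i + j) = 0.
Proof.
move=> TE.
have -> : \sum_(j < n.+2) \sum_(i < n.+1) T j i *~ (-1) ^+ (i + j) =
  \sum_(j < n.+2) \sum_(i < n.+1 | (i < j)%N) T j i *~ (-1) ^+ (i + j) +
  \sum_(j < n.+2) \sum_(i < n.+1 | (j <= i)%N) T j i *~ (-1) ^+ (i + j).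
  rewrite -big_split /=; apply: eq_bigr => j _.
  rewrite (bigID (fun i : 'I_n.+1 => (i < j)%N)) /=; congr (_ + _).
  by apply: eq_bigl => i; rewrite -leqNgt.
rewrite [X in X + _]big_ord_recl /= big_pred0 // add0r.
rewrite [X in _ + X]big_ord_recr /= [X in _ + (_ + X)]big_pred0; last first.
  by move=> i; rewrite leqNgt ltn_ord.
rewrite addr0 [X in _ + X](exchange_big_dep xpredT) //= -big_split /=.
apply: big1 => k _; rewrite -big_split /=; apply: big1 => i ik.
by rewrite TE // /bump /= add1n addnS exprS mulN1r mulrNz addnC addNr.
Qed.

Section SemicubicalHomology.
Variables (X : semicubical_set) (G : homological_system X).

Definition sc_chain (n : nat) : zmodType :=
  dsum (fun s : X n => G (existT _ n s)).

Definition sc_gen n (s : X n) : {additive G (existT _ n s) -> sc_chain n} :=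
  mk_additive (@dinj_is_additive _ (fun s : X n => G (existT _ n s)) s).

Lemma sc_chain_eq n (B : zmodType) (h k : {additive sc_chain n -> B}) :
  (forall s g, h (sc_gen s g) = k (sc_gen s g)) -> h =1 k.
Proof. by move=> hk; apply: dsum_additive_eq => s g; exact: hk. Qed.

(* the morphism (delta_i^e, d_i^e s, s), in the opposite category *)
Definition delta_cell n (i : 'I_n.+1) (e : bool) (s : X n.+1) :
    @hom (opcat (box_over X)) (existT _ n.+1 s) (existT _ n (sc_face i e s)) :=
  exist _ (bdelta i e) erefl.

Definition sc_bd_face n (i : 'I_n.+1) (e : bool) :
    {additive sc_chain n.+1 -> sc_chain n} :=
  dsum_elim (fun s => (sc_gen (sc_face i e s) \o afmap G (delta_cell i e s)
    : {additive G (existT _ n.+1 s) -> sc_chain n})).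

Lemma sc_bd_face_gen n i e (s : X n.+1) g :
  sc_bd_face i e (sc_gen s g) =
  sc_gen (sc_face i e s) (afmap G (delta_cell i e s) g).
Proof. exact: dsum_elim_inj. Qed.

Definition sc_bd_fun n (x : sc_chain n.+1) : sc_chain n :=
  \sum_(i < n.+1) (sc_bd_face i true x - sc_bd_face i false x) *~ (-1) ^+ i.+1.

Lemma sc_bd_is_additive n : zmod_morphism (@sc_bd_fun n).
Proof.
move=> x y; rewrite /sc_bd_fun -sumrB; apply: eq_bigr => i _.
by rewrite -mulrzBl 2!raddfB !opprD addrACA.
Qed.

Definition sc_bd n : {additive sc_chain n.+1 -> sc_chain n} :=
  mk_additive (@sc_bd_is_additive n).

Lemma sc_bd_bd n (x : sc_chain n.+2) : sc_bd n (sc_bd n.+1 x) = 0.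
Proof.
apply: (sc_chain_eq (h := sc_bd n \o sc_bd n.+1) (k := \0)) => s g.
pose e k (f : @hom box k n.+2) : sc_chain k :=
  sc_gen (sc_map X f s)
    (@afmap _ G (existT _ n.+2 s) (existT _ k (sc_map X f s)) (exist _ f erefl) g).
have eE k (f : @hom box k n.+2) t (p : sc_map X f s = t) : e k f = sc_gen t
    (@afmap _ G (existT _ n.+2 s) (existT _ k t) (exist _ f p) g).
  by subst t.
have eD k (f : @hom box k.+1 n.+2) i a :
    sc_bd_face i a (e k.+1 f) = e k (comp (bdelta i a) f).
  rewrite sc_bd_face_gen -afmapM.
  have p : sc_map X (comp (bdelta i a) f) s = sc_face i a (sc_map X f s).
    exact: (@sfmapM (opcat box)).
  rewrite (eE _ _ _ p); congr (sc_gen _ (afmap G _ _)).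
  exact: cell_hom_eq.
pose T (j : 'I_n.+2) (i : 'I_n.+1) : sc_chain n :=
  e n (comp (bdelta i true) (bdelta j true))
  - e n (comp (bdelta i false) (bdelta j true))
  - (e n (comp (bdelta i true) (bdelta j false))
  - e n (comp (bdelta i false) (bdelta j false))).
have bdE k (f : @hom box k.+1 n.+2) : sc_bd k (e k.+1 f) =
    \sum_(i < k.+1) (e k (comp (bdelta i true) f) - e k (comp (bdelta i false) f))
      *~ (-1) ^+ i.+1.
  by apply: eq_bigr => i _; rewrite !eD.
have -> : sc_gen s g = e n.+2 (idm (n.+2 : box)).
  have p : sc_map X (idm (n.+2 : box)) s = s by exact: (@sfmap1 (opcat box)).
  rewrite (eE _ _ _ p) -[g in LHS](@afmap1 _ G).
  by congr (sc_gen s (afmap G _ g)); apply: cell_hom_eq.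
rewrite -[LHS]/(sc_bd n (sc_bd n.+1 (e n.+2 (idm (n.+2 : box))))) bdE.
rewrite raddf_sum -[RHS](@alternating_sum0 _ n T) => [|i k ik]; last first.
  rewrite /T !bdelta_bdelta // !opprD !opprK -!addrA; congr (_ + _).
  by rewrite !addrA; congr (_ + _); rewrite addrC.
apply: eq_bigr => j _; rewrite !compm1 raddfMz raddfB !bdE -sumrB.
rewrite mulrz_suml; apply: eq_bigr => i _.
by rewrite -mulrzBl -/(T j i) -mulrzA -exprD addSn addnS !exprS mulrA mulrNN !mul1r.
Qed.

Definition semicubical_complex : chain_complex := ChainComplex sc_bd_bd.

Definition semicubical_homology (n : nat) : zmodType :=
  homology semicubical_complex n.

End SemicubicalHomology.

Section FreePartiallyCommutativeMonoid.
Variables (E : choiceType) (I : rel E).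

Inductive trace_cong : seq E -> seq E -> Prop :=
| trace_refl u : trace_cong u u
| trace_sym u v : trace_cong u v -> trace_cong v u
| trace_trans u v w : trace_cong u v -> trace_cong v w -> trace_cong u w
| trace_swap u v a b : I a b ->
    trace_cong (u ++ [:: a, b & v]) (u ++ [:: b, a & v]).

Definition trace_equiv : rel (seq E) := fun u v => `[< trace_cong u v >].

Lemma trace_equiv_is_equiv : equiv_class_of trace_equiv.
Proof.
split=> [u|u v|v u w]; rewrite /trace_equiv; first by apply/asboolP/trace_refl.
  by apply: asbool_equiv_eq; split; exact: trace_sym.
by move=> /asboolP uv /asboolP vw; apply/asboolP; exact: trace_trans vw.
Qed.

Canonical trace_equiv_equiv := EquivRelPack trace_equiv_is_equiv.
Canonical trace_equiv_encModRel := defaultEncModRel trace_equiv.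

Definition fpcm := {eq_quot trace_equiv}.
HB.instance Definition _ := EqQuotient.on fpcm.
HB.instance Definition _ := Choice.on fpcm.

(* the class of a word, i.e. the product of its letters *)
Definition word (u : seq E) : fpcm := \pi_fpcm u.
Definition gen (a : E) : fpcm := word [:: a].

Lemma wordP u v : word u = word v <-> trace_cong u v.
Proof.
by split=> [/eqP|uv]; [|apply/eqP]; rewrite /word eqmodE;
  [move/asboolP|apply/asboolP].
Qed.

Lemma trace_cong_cat u u' v v' :
  trace_cong u u' -> trace_cong v v' -> trace_cong (u ++ v) (u' ++ v').
Proof.
move=> uu' vv'; apply: (@trace_trans _ (u' ++ v)).
  elim: uu' v {vv'} => [w|w x _ IH|w x y _ IH1 _ IH2|w x a b ab] v.
  - exact: trace_refl.
  - exact: trace_sym.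
  - exact: trace_trans (IH1 v) (IH2 v).
  - by rewrite -!catA /=; exact: trace_swap.
elim: vv' => [w|w x _ IH|w x y _ IH1 _ IH2|w x a b ab].
- exact: trace_refl.
- exact: trace_sym.
- exact: trace_trans IH1 IH2.
- by rewrite !catA; exact: trace_swap.
Qed.

Definition fpcm_one : fpcm := word [::].
Definition fpcm_mul (x y : fpcm) : fpcm := word (repr x ++ repr y).

Lemma fpcm_mul_word u v : fpcm_mul (word u) (word v) = word (u ++ v).
Proof. by apply/wordP; apply: trace_cong_cat; apply/wordP; rewrite /word reprK. Qed.

Lemma word_surj (x : fpcm) : exists u, x = word u.
Proof. by exists (repr x); rewrite /word reprK. Qed.

Lemma fpcm_mulA : associative fpcm_mul.
Proof.
move=> x y z; have [[[u ->] [v ->]] [w ->]] :=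
  (word_surj x, word_surj y, word_surj z).
by rewrite !fpcm_mul_word catA.
Qed.

Lemma fpcm_mul1 : left_id fpcm_one fpcm_mul.
Proof. by move=> x; have [u ->] := word_surj x; rewrite fpcm_mul_word. Qed.

Lemma fpcm_mulm1 : right_id fpcm_one fpcm_mul.
Proof. by move=> x; have [u ->] := word_surj x; rewrite fpcm_mul_word cats0. Qed.

HB.instance Definition _ := isMonoid.Build fpcm fpcm_mulA fpcm_mul1 fpcm_mulm1.

Lemma word_cat u v : word (u ++ v) = (word u * word v)%g.
Proof. by rewrite -fpcm_mul_word. Qed.

Lemma word_cons a u : word (a :: u) = (gen a * word u)%g.
Proof. by rewrite -word_cat. Qed.

Lemma word_nil : word [::] = 1%g.
Proof. by []. Qed.

Lemma genC a b : I a b -> (gen a * gen b = gen b * gen a)%g.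
Proof.
by move=> ab; rewrite -!word_cat; apply/wordP; exact: (@trace_swap [::] [::]).
Qed.

Definition commuting_set (A : set E) : Prop :=
  forall a b, A a -> A b -> a <> b -> I a b.

Definition maximal_commuting_set (A : set E) : Prop :=
  commuting_set A /\ forall B, commuting_set B -> A `<=` B -> B `<=` A.

Definition locally_finite_dimensional : Prop :=
  forall A, maximal_commuting_set A -> finite_set A.

End FreePartiallyCommutativeMonoid.
Arguments gen {E} I a.

Record right_mset (M : monoidType) := RightMset {
  mset_sort :> Type;
  mact : mset_sort -> M -> mset_sort;
  mact1 : forall x, mact x 1%g = x;
  mactM : forall x a b, mact x (a * b)%g = mact (mact x a) b }.

Section MsetCategory.
Variables (M : monoidType) (X : right_mset M).

Definition mset_hom (x y : X) := {mu : M | mact x mu = y}.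

Lemma mset_hom_eq x y (f g : mset_hom x y) : sval f = sval g -> f = g.
Proof. by case: f g => [f fP] [g gP] /= fg; subst g; congr exist. Qed.

Definition mset_id (x : X) : mset_hom x x := exist _ 1%g (mact1 x).

Lemma mset_comp_subproof (x y z : X) (f : mset_hom x y) (g : mset_hom y z) :
  mact x (sval f * sval g)%g = z.
Proof. by case: f g => [f fP] [g gP] /=; rewrite mactM fP. Qed.

Definition mset_comp x y z (f : mset_hom x y) (g : mset_hom y z) :
  mset_hom x z := exist _ _ (mset_comp_subproof f g).

Lemma mset_comp1m x y (f : mset_hom x y) : mset_comp (mset_id x) f = f.
Proof. by apply: mset_hom_eq; exact: mul1g. Qed.

Lemma mset_compm1 x y (f : mset_hom x y) : mset_comp f (mset_id y) = f.
Proof. by apply: mset_hom_eq; exact: mulg1. Qed.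

Lemma mset_compA x y z t (f : mset_hom x y) (g : mset_hom y z)
    (h : mset_hom z t) :
  mset_comp f (mset_comp g h) = mset_comp (mset_comp f g) h.
Proof. by apply: mset_hom_eq; exact: mulgA. Qed.

(* the category (M/X)^op *)
Definition mset_cat : category :=
  @Category X mset_hom mset_id mset_comp mset_comp1m mset_compm1 mset_compA.

Definition mact_hom (x : X) (mu : M) : @hom mset_cat x (mact x mu) :=
  exist _ mu erefl.

End MsetCategory.

Section Masks.
Variables (E : choiceType) (I r : rel E).
Hypothesis rI : forall a b, r a b -> I a b.

(* If u = f (0, .., 0) and v = f (1, .., 1) for a face f : I^m -> I^n, this
   selects the coordinates of f that are not constant. *)
Definition xor_mask (u v : seq bool) : bitseq :=
  [seq p.1 (+) p.2 | p <- zip u v].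

Lemma xor_mask_ins i e u v : size u = size v ->
  xor_mask (ins i e u) (ins i e v) = ins i false (xor_mask u v).
Proof.
elim: u v i => [|a u IH] [|b v] i // => [_|[uv]].
  by case: i => [|i]; rewrite /xor_mask /ins /= addbb.
case: i => [|i]; first by rewrite /xor_mask /ins /= ?take0 ?drop0 addbb.
by have := IH v i uv; rewrite /xor_mask /ins /= => ->.
Qed.

Lemma size_xor_mask u v : size u = size v -> size (xor_mask u v) = size u.
Proof. by move=> uv; rewrite size_map size1_zip // uv. Qed.

Lemma mask_ins_false i (u : bitseq) (s : seq E) :
  size s = (size u).+1 -> (i < size s)%N -> mask (ins i false u) s = mask u (del i s).
Proof.
elim: i u s => [|i IH] [|b u] [|a s] //=.
  by rewrite /del take0 drop1.
by move=> [su] si; have := IH u s su si; rewrite /ins /del /= => ->; case: b.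
Qed.

Lemma word_mask_ins_true i (u : bitseq) (s : seq E) x :
  size s = (size u).+1 -> (i < size s)%N -> pairwise r s ->
  word I (mask (ins i true u) s) =
  (gen I (nth x s i) * word I (mask u (del i s)))%g.
Proof.
elim: i u s => [|i IH] u [|a s] //; first by rewrite /del /ins take0 drop0 drop1 /= word_cons.
case: u => [|b u] [su] si /andP[/allP ra rs]; first by move: si; rewrite /= su.
have := IH u s su si rs.
rewrite /ins /del /=; case: b => //= e.
rewrite !word_cons {}e !mulgA genC //; apply: rI; apply: ra.
by rewrite mem_nth.
Qed.

(* the coordinates of f : I^m -> I^n whose value is constantly 1 *)
Definition ones m n (f : cube m -> cube n) : bitseq := f [tuple of nseq m false].

Definition free_coords m n (f : cube m -> cube n) : bitseq :=
  xor_mask (f [tuple of nseq m false]) (f [tuple of nseq m true]).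

Lemma size_ones m n (f : cube m -> cube n) : size (ones f) = n.
Proof. by rewrite size_tuple. Qed.

Lemma size_free_coords m n (f : cube m -> cube n) : size (free_coords f) = n.
Proof. by rewrite size_xor_mask !size_tuple. Qed.

Lemma ones_id m : ones (fun x : cube m => x) = nseq m false.
Proof. by []. Qed.

Lemma free_coords_id m : free_coords (fun x : cube m => x) = nseq m true.
Proof. by rewrite /free_coords /xor_mask /=; elim: m => //= m ->. Qed.

Lemma ones_delta m n (f : cube m -> cube n) (i : 'I_n.+1) e :
  ones (fun x => delta i e (f x)) = ins i e (ones f).
Proof. by []. Qed.

Lemma free_coords_delta m n (f : cube m -> cube n) (i : 'I_n.+1) e :
  free_coords (fun x => delta i e (f x)) = ins i false (free_coords f).
Proof. by rewrite /free_coords /= xor_mask_ins // !size_tuple. Qed.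

Lemma count_free_coords m n (f : cube m -> cube n) :
  is_face f -> count id (free_coords f) = m.
Proof.
elim=> [|k g i e _ IH]; first by rewrite free_coords_id count_nseq mul1n.
rewrite free_coords_delta /ins count_cat /= add0n -count_cat cat_take_drop.
exact: IH.
Qed.

Lemma mask_free_coords_comp m n p (f : cube m -> cube n) (g : cube n -> cube p)
    (s : seq E) : is_face g -> size s = p ->
  mask (free_coords f) (mask (free_coords g) s) =
  mask (free_coords (fun x => g (f x))) s.
Proof.
move=> gP; elim: gP s => [|k h i e hP IH] s ss.
  by rewrite free_coords_id mask_true ?ss.
rewrite !free_coords_delta !mask_ins_false ?ss ?size_free_coords //.
by rewrite IH // size_del ss.
Qed.

Lemma word_ones_comp m n p (f : cube m -> cube n) (g : cube n -> cube p)
    (s : seq E) : is_face g -> size s = p -> pairwise r s ->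
  (word I (mask (ones g) s) * word I (mask (ones f) (mask (free_coords g) s)))%g =
  word I (mask (ones (fun x => g (f x))) s).
Proof.
move=> gP; elim: gP s => [|k h i e hP IH] s ss rs.
  by rewrite free_coords_id ones_id mask_false mask_true ?ss // word_nil mul1g.
rewrite !ones_delta free_coords_delta.
rewrite [mask (ins i false _) s]mask_ins_false ?ss ?size_free_coords //.
have sd : size (del i s) = k by rewrite size_del ss.
have rd : pairwise r (del i s).
  by have [mm ->] := del_mask i s; exact: pairwise_mask.
case: e.
  have x : E by case: (s) ss.
  rewrite !(@word_mask_ins_true i _ s x) ?ss ?size_ones //.
  by rewrite -mulgA IH.
by rewrite !mask_ins_false ?ss ?size_ones // IH.
Qed.

End Masks.

Section CubicalSetOfMset.
Variables (d : Order.disp_t) (E : orderType d) (I : rel E).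
Variable X : right_mset (fpcm I).

Definition ltI : rel E := fun a b => (a < b)%O && I a b.

Lemma ltI_I a b : ltI a b -> I a b.
Proof. by case/andP. Qed.

(* the elements (x, a_1, .., a_n) of Q_n X *)
Record Qcell (n : nat) := QCell {
  Qpt : X;
  Qgens : n.-tuple E;
  Qgens_ltI : pairwise ltI Qgens }.

Lemma Qcell_eq n (q q' : Qcell n) :
  Qpt q = Qpt q' -> Qgens q = Qgens q' :> seq E -> q = q'.
Proof.
case: q q' => [x a aP] [y b bP] /= <- /val_inj ab; subst b.
by congr QCell; exact: bool_irrelevance.
Qed.

Section Action.
Variables (m n : nat) (f : face m n) (q : Qcell n).

Definition Qmap_word : fpcm I := word I (mask (ones (sval f)) (Qgens q)).

Lemma Qmap_size : size (mask (free_coords (sval f)) (Qgens q)) == m.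
Proof.
by rewrite size_mask ?(count_free_coords (svalP f)) // size_free_coords size_tuple.
Qed.

Lemma Qmap_ltI : pairwise ltI (Tuple Qmap_size).
Proof. exact: pairwise_mask (Qgens_ltI q). Qed.

(* The face f of (x, a_1, .., a_n): the letters at the coordinates where f is
   constantly 1 act on x, those at the coordinates where f is constantly 0 are
   forgotten.  See [Q_faceE] for f = delta_i^e. *)
Definition Qmap : Qcell m := QCell (mact (Qpt q) Qmap_word) Qmap_ltI.

End Action.

Lemma Qmap1 n (q : Qcell n) : Qmap (face_id n) q = q.
Proof.
apply: Qcell_eq; rewrite /= /Qmap_word /=.
  by rewrite ones_id mask_false word_nil mact1.
by rewrite free_coords_id mask_true ?size_tuple.
Qed.

Lemma Qmap_word_comp m n p (f : face m n) (g : face n p) (q : Qcell p) :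
  Qmap_word (face_comp f g) q = (Qmap_word g q * Qmap_word f (Qmap g q))%g.
Proof.
symmetry; apply: (word_ones_comp ltI_I (sval f) (svalP g)).
  exact: size_tuple.
exact: Qgens_ltI.
Qed.

Lemma QmapM m n p (f : face m n) (g : face n p) (q : Qcell p) :
  Qmap (face_comp f g) q = Qmap f (Qmap g q).
Proof.
apply: Qcell_eq; first by rewrite /= Qmap_word_comp mactM.
by rewrite /= (mask_free_coords_comp (sval f) (svalP g)) // size_tuple.
Qed.

Definition Q : semicubical_set :=
  @SetFunctor (opcat box) Qcell (fun _ _ f => Qmap f) Qmap1
    (fun _ _ _ g f q => QmapM f g q).

Section Omit.
Variables (n : nat) (y : X) (q : Qcell n.+1) (i : 'I_n.+1).

Lemma Qomit_size : size (del i (Qgens q)) == n.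
Proof. by rewrite size_del size_tuple. Qed.

Lemma Qomit_ltI : pairwise ltI (Tuple Qomit_size).
Proof.
by rewrite /=; have [u ->] := del_mask i (Qgens q);
  exact: pairwise_mask (Qgens_ltI q).
Qed.

(* (y, a_1, .., a_n) with the i-th letter omitted, for q = (x, a_1, .., a_n) *)
Definition Qomit : Qcell n := QCell y Qomit_ltI.

End Omit.

Lemma Qmap_word_delta n (i : 'I_n.+1) (e : bool) (q : Qcell n.+1) :
  Qmap_word (bdelta i e) q = if e then gen I (tnth (Qgens q) i) else 1%g.
Proof.
rewrite /Qmap_word -[ones _]/(ins i e (ones (fun x : cube n => x))) ones_id.
case: e.
  rewrite (word_mask_ins_true ltI_I (tnth (Qgens q) i)) ?size_nseq ?size_tuple //.
    by rewrite mask_false word_nil mulg1 -tnth_nth.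
  exact: Qgens_ltI.
by rewrite mask_ins_false ?size_nseq ?size_tuple // mask_false.
Qed.

Lemma Q_faceE n (i : 'I_n.+1) (e : bool) (q : Q n.+1) :
  sc_face i e q =
  Qomit (mact (Qpt q) (if e then gen I (tnth (Qgens q) i) else 1%g)) q i.
Proof.
apply: Qcell_eq; first by rewrite /= Qmap_word_delta.
rewrite /= free_coords_delta free_coords_id mask_ins_false ?size_nseq ?size_tuple //.
by rewrite mask_true // size_del size_tuple.
Qed.

Section HomologicalSystem.
Variable F : ab_functor (mset_cat X).

Lemma Fbar_subproof (s t : opcat (box_over Q)) (f : hom s t) :
  mact (Qpt (projT2 s)) (Qmap_word (sval f) (projT2 s)) = Qpt (projT2 t).
Proof. by case: f => [f fP] /=; rewrite -fP. Qed.

Definition Fbar_hom (s t : opcat (box_over Q)) (f : hom s t) :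
    @hom (mset_cat X) (Qpt (projT2 s)) (Qpt (projT2 t)) :=
  exist _ _ (Fbar_subproof f).

Lemma Fbar1 (s : opcat (box_over Q)) x : afmap F (Fbar_hom (idm s)) x = x.
Proof.
rewrite -[RHS](@afmap1 _ F); congr (afmap F _ x); apply: mset_hom_eq.
by rewrite /= /Qmap_word /= ones_id mask_false.
Qed.

Lemma FbarM (s t u : opcat (box_over Q)) (f : hom s t) (g : hom t u) x :
  afmap F (Fbar_hom (comp f g)) x =
  afmap F (Fbar_hom g) (afmap F (Fbar_hom f) x).
Proof.
rewrite -afmapM; congr (afmap F _ x); apply: mset_hom_eq.
case: f g => [f fP] [g gP].
by rewrite [LHS]/= (Qmap_word_comp g f) -[Qmap f _]/(sc_map Q f _) fP.
Qed.

(* Fbar (x, a_1, .., a_n) = F x, with delta_i^e acting by x --a_i^e--> x a_i^e *)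
Definition Fbar : homological_system Q :=
  @AbFunctor (opcat (box_over Q)) (fun s => F (Qpt (projT2 s)))
    (fun _ _ f => afmap F (Fbar_hom f)) Fbar1 FbarM.

Definition Q_chain (n : nat) : zmodType := dsum (fun q : Qcell n => F (Qpt q)).

(* the element (x, a_1, .., a_n, g), for q = (x, a_1, .., a_n) *)
Definition Q_gen n (q : Qcell n) (g : F (Qpt q)) : Q_chain n :=
  @dinj _ (fun q : Qcell n => F (Qpt q)) q g.

Lemma Q_gen_eq n (q q' : Qcell n) x (mu mu' : fpcm I) (p : mact x mu = Qpt q)
    (p' : mact x mu' = Qpt q') g : q = q' -> mu = mu' ->
  Q_gen (afmap F (exist _ mu p : @hom (mset_cat X) x (Qpt q)) g) =
  Q_gen (afmap F (exist _ mu' p' : @hom (mset_cat X) x (Qpt q')) g).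
Proof. by move=> eq emu; subst q' mu'; rewrite (Prop_irrelevance p p'). Qed.

(* d_n (x, a_1, .., a_n, g); letters are numbered from 0, hence the sign *)
Definition Q_bd_gen n (q : Qcell n.+1) (g : F (Qpt q)) : Q_chain n :=
  \sum_(s < n.+1)
    (let a_s := gen I (tnth (Qgens q) s) in
     Q_gen (q := Qomit (mact (Qpt q) a_s) q s) (afmap F (mact_hom (Qpt q) a_s) g)
     - Q_gen (q := Qomit (Qpt q) q s) g) *~ (-1) ^+ s.+1.

Lemma Q_bd_gen_is_additive n q : zmod_morphism (@Q_bd_gen n q).
Proof.
move=> g h; rewrite /Q_bd_gen -sumrB; apply: eq_bigr => s _.
by rewrite -mulrzBl /Q_gen /= 3!raddfB !opprD addrACA.
Qed.

Definition Q_bd n : {additive Q_chain n.+1 -> Q_chain n} :=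
  dsum_elim (fun q => mk_additive (@Q_bd_gen_is_additive n q)).

Lemma Q_bdE n (q : Qcell n.+1) (g : F (Qpt q)) : Q_bd n (Q_gen g) = Q_bd_gen g.
Proof. exact: dsum_elim_inj. Qed.

Lemma Q_bd_sc n : Q_bd n =1 sc_bd Fbar n.
Proof.
apply: dsum_additive_eq => q g; rewrite -[LHS]/(Q_bd n (Q_gen g)) Q_bdE.
rewrite -[RHS]/(sc_bd_fun (@sc_gen Q Fbar n.+1 q g)).
apply: eq_bigr => s _; congr (_ *~ _); rewrite !sc_bd_face_gen.
congr (_ - _).
  by apply: Q_gen_eq; [rewrite Q_faceE|rewrite /= Qmap_word_delta].
rewrite -[g in LHS](@afmap1 _ F).
by apply: Q_gen_eq; [rewrite Q_faceE /= mact1|rewrite /= Qmap_word_delta].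
Qed.

Lemma Q_bd_bd n (x : Q_chain n.+2) : Q_bd n (Q_bd n.+1 x) = 0.
Proof. by rewrite !Q_bd_sc; exact: (@sc_bd_bd Q Fbar n x). Qed.

Definition Q_complex : chain_complex := ChainComplex Q_bd_bd.

End HomologicalSystem.
End CubicalSetOfMset.

(* Main.v *)
Require Import Defs.
From mathcomp Require Import all_boot all_order all_algebra.
From mathcomp Require Import boolp classical_sets cardinality.

(* Let P -> F be the given projective resolution.  The groups Q_p X with
   coefficients in P_q form a double complex.  Augmented towards F, it is exact
   in the direction of q because direct sums are exact; augmented towards
   colim P_q, it is exact in the direction of p, so both augmentations compute
   the same homology.

   Exactness in the direction of p says that H_0 is the colimit and that a
   projective functor has no higher homology.  A projective functor being a
   retract of a free one, it is enough to contract the complex spanned by the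
   pairs (mu, s), with mu a trace and s an increasing clique.  Its differential
   is a part that preserves the trace w = mu * s minus a part that shortens it.
   The pairs of weight w <> 1 are the faces s of the simplex on the letters that
   divide w on the right, which form a clique, and coning off at the largest
   such letter contracts the first part; the second is handled by induction on
   the length of w. *)

Set Implicit Arguments.
Unset Strict Implicit.
Unset Printing Implicit Defensive.

Import Order.TTheory GRing.Theory.
Local Open Scope ring_scope.

(** * Double complexes *)

(** Zigzags relate cycles of the two complexes without being a map. Additivity and the matching of
    images make such a relation descend to a bijection between classes. *)
Lemma coker_iso_of_rel (A B A' B' : zmodType) (f : {additive A' -> A})
    (g : {additive B' -> B}) (R : A -> B -> Prop) :
  (forall a a' b b', R a b -> R a' b' -> R (a - a') (b - b')) ->
  (forall a, exists b, R a b) -> (forall b, exists a, R a b) ->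
  (forall a b, R a b -> (exists a', f a' = a) <-> (exists b', g b' = b)) ->
  zmod_iso (coker f) (coker g).
Proof.
move=> RB Rl Rr Rim.
have Rpi a a' b b' : R a b -> R a' b' ->
    coker_pi f a = coker_pi f a' <-> coker_pi g b = coker_pi g b'.
  by move=> ab ab'; rewrite !coker_piP; exact/Rim/RB.
have ex q : exists r, exists a b, [/\ coker_pi f a = q, coker_pi g b = r & R a b].
  have [a <-] := coker_pi_surj q; have [b ab] := Rl a.
  by exists (coker_pi g b), a, b.
pose h q := sval (cid (ex q)).
have hE a b : R a b -> h (coker_pi f a) = coker_pi g b.
  move=> ab; rewrite /h; case: cid => r /= [a' [b' [ea <- ab']]].
  exact/(Rpi _ _ _ _ ab' ab).
have hB : zmod_morphism h.
  move=> q r; have [a <-] := coker_pi_surj q; have [a' <-] := coker_pi_surj r.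
  have [[b ab] [b' ab']] := (Rl a, Rl a').
  by rewrite -raddfB (hE _ _ (RB _ _ _ _ ab ab')) (hE _ _ ab) (hE _ _ ab') raddfB.
exists (mk_additive hB).
have ey r : exists q, h q = r.
  have [b <-] := coker_pi_surj r; have [a ab] := Rr b.
  by exists (coker_pi f a); exact: hE.
exists (fun r => sval (cid (ey r))) => [q|r]; last by rewrite /=; case: cid.
case: cid => q' /=.
have [a <-] := coker_pi_surj q; have [a' <-] := coker_pi_surj q'.
have [[b ab] [b' ab']] := (Rl a, Rl a').
by rewrite (hE _ _ ab) (hE _ _ ab') => /(Rpi _ _ _ _ ab' ab).
Qed.

Lemma is_cycleS (C : chain_complex) n (x : C n.+1) :
  (x \in @is_cycle C n.+1) = (bd C n x == 0).
Proof. by []. Qed.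

Lemma bd_cycle_imP (C : chain_complex) n (c : Defs.cycle C n) :
  (exists y, bd_cycle y = c) <-> exists y, bd C n y = cycle_val c.
Proof.
split=> -[y]; first by move=> <-; exists y.
by move=> yc; exists y; apply: val_inj.
Qed.

Lemma choice_dep J (A : J -> Type) (P : forall j, A j -> Prop) :
  (forall j, exists y, P j y) -> exists g, forall j, P j (g j).
Proof.
by move=> ex; exists (fun j => sval (cid (ex j))) => j; exact: (svalP (cid (ex j))).
Qed.

Lemma family_with (A : nat -> zmodType) n (y : A n) :
  exists f : forall j, A j, f n = y.
Proof. by exists (@dfwith nat A (fun=> 0) n y); rewrite dfwith_in. Qed.

(** The type of states varies with the index. Carrying the invariant inside a sigma type lets each
    successor be chosen by plain recursion. *)
Lemma dependent_choice_nat (S : nat -> Type) (Inv : forall i, S i -> Prop)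
    (R : forall i, S i -> S i.+1 -> Prop) (f0 : S 0) :
  Inv 0 f0 -> (forall i f, Inv i f -> exists g, R i f g /\ Inv i.+1 g) ->
  exists f : forall i, S i, f 0 = f0 /\ forall i, R i (f i) (f i.+1).
Proof.
move=> f0I step.
pose T i := {f : S i | Inv i f}.
have next i (f : T i) : {g : T i.+1 | R i (sval f) (sval g)}.
  by have [g [fg gI]] := cid (step i _ (svalP f)); exists (exist _ g gI).
pose F := nat_rect T (exist _ f0 f0I) (fun i f => sval (next i f)).
by exists (fun i => sval (F i)); split=> // i; exact: (svalP (next i (F i))).
Qed.

Section DoubleComplex.
Variables (D : nat -> nat -> zmodType) (A B : chain_complex).
Variable d : forall p q, {additive D p.+1 q -> D p q}.
Variable e : forall p q, {additive D p q.+1 -> D p q}.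
Variable alpha : forall q, {additive D 0 q -> A q}.
Variable beta : forall p, {additive D p 0 -> B p}.

(** The two differentials commute instead of anticommuting: no total complex is formed, so no signs
    are needed. *)
Record double_resolution : Prop := DoubleResolution {
  dr_comm : forall p q x, d p q (e p.+1 q x) = e p q (d p q.+1 x);
  dr_alpha_e : forall q x, alpha q (e 0 q x) = bd A q (alpha q.+1 x);
  dr_beta_d : forall p x, beta p (d p 0 x) = bd B p (beta p.+1 x);
  dr_alpha_surj : forall q a, exists x, alpha q x = a;
  dr_alpha_exact : forall q x, alpha q x = 0 <-> exists y, d 0 q y = x;
  dr_d_exact : forall p q x, d p q x = 0 <-> exists y, d p.+1 q y = x;
  dr_beta_surj : forall p b, exists x, beta p x = b;
  dr_beta_exact : forall p x, beta p x = 0 <-> exists y, e p 0 y = x;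
  dr_e_exact : forall p q x, e p q x = 0 <-> exists y, e p q.+1 y = x }.

(* Only the entries x i j with i + j = n matter; quantifying over whole
   families avoids casts between D i (n - i) and its neighbours. *)
Definition zigzag n (a : A n) (b : B n) : Prop :=
  exists x : forall i j, D i j,
    [/\ alpha n (x 0 n) = a, beta n (x n 0) = b &
        forall i j, (i + j.+1)%N = n -> e i j (x i j.+1) = d i j (x i.+1 j)].

Lemma zigzagB n (a a' : A n) (b b' : B n) :
  zigzag a b -> zigzag a' b' -> zigzag (a - a') (b - b').
Proof.
move=> [x [<- <- xx]] [y [<- <- yy]]; exists (fun i j => x i j - y i j).
by split=> [||i j ij]; rewrite !raddfB // xx ?yy.
Qed.

Hypothesis res : double_resolution.

Lemma zigzag_cycle n (a : A n) (b : B n) : zigzag a b -> b \in @is_cycle B n.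
Proof.
case: n a b => [//|n] a b [x [_ <- xx]]; rewrite is_cycleS -(dr_beta_d res).
rewrite -xx ?addn1 //; apply/eqP/(dr_beta_exact res).
by exists (x n 1).
Qed.

Lemma zigzag_total n (a : A n) : a \in @is_cycle A n -> exists b, zigzag a b.
Proof.
move=> aC; have [x0 x0a] := dr_alpha_surj res a.
have [f0 f0E] := @family_with (D 0) _ x0.
(* The invariant says that the zigzag can be continued. It starts because [a] is a cycle, and passes
   on because [d] commutes with [e] and [e] composed with itself is zero. *)
pose Inv i (f : forall j, D i j) := forall j, (i + j.+1)%N = n ->
  exists y, d i j y = e i j (f j.+1).
pose R i (f : forall j, D i j) (g : forall j, D i.+1 j) :=
  forall j, (i + j.+1)%N = n -> e i j (f j.+1) = d i j (g j).
have [|i f fI|x [ex xx]] := @dependent_choice_nat (fun i => forall j, D i j) Inv R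
  f0.
- move=> j jn; rewrite add0n in jn; subst n; apply/(dr_alpha_exact res).
  by rewrite f0E (dr_alpha_e res) x0a; apply/eqP.
- have /choice_dep[g gP] j : exists y, (i + j.+1)%N = n -> e i j (f j.+1) = d i j y.
    have [/fI[y yP]|ne] := pselect ((i + j.+1)%N = n); last by exists 0.
    by exists y.
  exists g; split=> // j jn; apply/(dr_d_exact res).
  rewrite (dr_comm res) -gP; last by rewrite addnS -addSn.
  by apply/(dr_e_exact res); exists (f j.+2).
exists (beta n (x n 0)), x; split=> [||i j]; [by rewrite ex f0E|by []|exact: xx].
Qed.

(** The zigzag minus the [e]-boundary of a growing family [y] is lifted along [d] step by step; the
    last lift [y n.+1 0] maps to [b']. *)
Lemma zigzag_boundary n (a : A n.+1) (b : B n) :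
  zigzag (bd A n a) b -> exists b', bd B n b' = b.
Proof.
move=> [x [xa <- xx]]; have [y0 y0a] := dr_alpha_surj res a.
have [f0 f0E] := @family_with (D 0) _ y0.
pose Inv i (f : forall j, D i j) := forall j, (i + j)%N = n ->
  exists y, d i j y = x i j - e i j (f j.+1).
pose R i (f : forall j, D i j) (g : forall j, D i.+1 j) :=
  forall j, (i + j)%N = n -> x i j - e i j (f j.+1) = d i j (g j).
have [|i f fI|y [ey yy]] := @dependent_choice_nat (fun i => forall j, D i j) Inv R
  f0.
- move=> j jn; rewrite add0n in jn; subst j; apply/(dr_alpha_exact res).
  by rewrite raddfB (dr_alpha_e res) f0E y0a xa subrr.
- have /choice_dep[g gP] j : exists y, (i + j)%N = n -> x i j - e i j (f j.+1) = d i j y.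
    have [/fI[y yP]|ne] := pselect ((i + j)%N = n); last by exists 0.
    by exists y.
  exists g; split=> // j jn; apply/(dr_d_exact res).
  rewrite raddfB (dr_comm res) -gP ?addnS // -xx ?addnS // raddfB opprB addrC subrK.
  by apply/(dr_e_exact res); exists (f j.+2).
exists (beta n.+1 (y n.+1 0)); rewrite -(dr_beta_d res) -yy ?addn0 //.
rewrite raddfB; apply/eqP; rewrite subr_eq addrC -subr_eq subrr eq_sym; apply/eqP.
by apply/(dr_beta_exact res); exists (y n 1).
Qed.

End DoubleComplex.

(** Lets the chases above be run from [B] to [A] as well. *)
Lemma double_resolution_sym D A B d e alpha beta :
  @double_resolution D A B d e alpha beta ->
  @double_resolution (fun p q => D q p) B A (fun p q => e q p) (fun p q => d q p)
    beta alpha.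
Proof. by case=> *; split. Qed.

Lemma zigzag_sym D (A B : chain_complex) d e alpha beta n (a : A n) (b : B n) :
  @zigzag D A B d e alpha beta n a b ->
  @zigzag (fun p q => D q p) B A (fun p q => e q p) (fun p q => d q p)
    beta alpha n b a.
Proof.
move=> [x [xa xb xx]]; exists (fun i j => x j i); split=> // i j ij.
by rewrite xx // addnS addnC -addnS.
Qed.

Lemma double_resolution_homology D (A B : chain_complex) d e alpha beta n :
  @double_resolution D A B d e alpha beta -> zmod_iso (homology A n) (homology B n).
Proof.
move=> res; have res' := double_resolution_sym res.
apply: (@coker_iso_of_rel _ _ _ _ _ _
  (fun a b => zigzag d e alpha beta (cycle_val a) (cycle_val b))).
- by move=> a a' b b'; exact: zigzagB.
- move=> a; have [b ab] := zigzag_total res (cycleP a).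
  by exists (Cycle (zigzag_cycle res ab)).
- move=> b; have [a /zigzag_sym ab] := zigzag_total res' (cycleP b).
  by exists (Cycle (zigzag_cycle res' (zigzag_sym ab))).
- move=> a b ab; rewrite !bd_cycle_imP; split=> -[y yE]; rewrite -yE in ab.
    exact: (zigzag_boundary res ab).
  exact: (zigzag_boundary res' (zigzag_sym ab)).
Qed.

(** * Right division in trace monoids *)

Section RightDivision.
Variables (E : choiceType) (I : rel E).
Hypotheses (I_sym : symmetric I) (I_irr : irreflexive I).
Implicit Types (a b : E) (u v : seq E) (w : fpcm I).

(** Right division on words: the removed occurrence of [a] commutes with all letters to its right,
    hence can be moved to the end. *)
Fixpoint rdel a u : option (seq E) :=
  if u is b :: u' then
    if rdel a u' is Some v then Some (b :: v)
    else if (b == a) && all (I a) u' then Some u' else None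
  else None.

Lemma rdel_rcons a b u : rdel a (rcons u b) =
  if b == a then Some u else if I a b then omap (rcons^~ b) (rdel a u) else None.
Proof.
elim: u => [|c u IH] /=; first by rewrite andbT; case: eqP => //; rewrite if_same.
rewrite {}IH all_rcons; case: (eqVneq b a) => // ba.
case: (I a b) => /=; last by rewrite andbF.
by case: (rdel a u) => //=; case: ifP.
Qed.

Lemma gen_mul_all a u : all (I a) u -> (gen I a * word I u = word I u * gen I a)%g.
Proof.
elim: u => [_|b u IH /= /andP[ab /IH au]]; first by rewrite word_nil mul1g mulg1.
by rewrite word_cons -mulgA -au !mulgA genC.
Qed.

Lemma rdel_word a u v : rdel a u = Some v -> word I u = (word I v * gen I a)%g.
Proof.
elim: u v => [//|b u IH] v /=; case: (rdel a u) IH => [v' IH [<-]|_].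
  by rewrite !word_cons (IH v') // mulgA.
by case: andP => // -[/eqP-> au [<-]]; rewrite word_cons gen_mul_all.
Qed.

Lemma trace_cong_all a u v : trace_cong I u v -> all (I a) u = all (I a) v.
Proof.
elim=> [//|//|x y z _ -> _ -> //|x y b c _].
by rewrite !all_cat /=; case: (I a b) (I a c) => [] [].
Qed.

(** Makes right division well defined on traces. In a swapped pair irreflexivity prevents both
    letters from being [a], and symmetry lets a removed letter pass its neighbour in either
    order. *)
Lemma trace_cong_rdel a u v : trace_cong I u v ->
  omap (word I) (rdel a u) = omap (word I) (rdel a v).
Proof.
elim=> [//|x y _ -> //|x y z _ -> _ -> //|x y b c bc].
elim: x => [|x s IH] /=.
  case ey: (rdel a y) => [y'|] /=.
    by congr Some; rewrite !word_cons !mulgA genC.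
  have cb : I c b by rewrite I_sym.
  case: (eqVneq c a) => [ca|_] /=; case: (eqVneq b a) => [ba|_] //=.
  - by move: bc; rewrite ca ba I_irr.
  - by rewrite -ca cb; case: all.
  - by rewrite -ba bc; case: all.
have -> : all (I a) (s ++ [:: b, c & y]) = all (I a) (s ++ [:: c, b & y]).
  exact/trace_cong_all/trace_swap.
case: (rdel a _) IH => [u'|]; case: (rdel a _) => [v'|] //=.
  by move=> [uv]; rewrite !word_cons uv.
move=> _; case: ifP => // _; congr Some; apply/wordP; exact: trace_swap.
Qed.

Definition rdiv a w : option (fpcm I) := omap (word I) (rdel a (repr w)).

Lemma rdiv_word a u : rdiv a (word I u) = omap (word I) (rdel a u).
Proof. by apply: trace_cong_rdel; apply/wordP; rewrite /word reprK. Qed.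

Lemma rdivK a w (v : fpcm I) : rdiv a w = Some v -> w = (v * gen I a)%g.
Proof.
have [u ->] := word_surj w; rewrite rdiv_word.
by case ev: (rdel a u) => [v'|] // -[<-]; exact: rdel_word.
Qed.

Lemma rdiv_mul_gen a b w : rdiv a (w * gen I b)%g =
  if b == a then Some w
  else if I a b then omap (fun v : fpcm I => v * gen I b)%g (rdiv a w) else None.
Proof.
have [u ->] := word_surj w; rewrite rdiv_word -word_cat cats1 rdiv_word rdel_rcons.
case: ifP => // _; case: ifP => // _.
by case: (rdel a u) => //= v; rewrite -cats1 word_cat.
Qed.

Lemma rdiv_mulK a w : rdiv a (w * gen I a)%g = Some w.
Proof. by rewrite rdiv_mul_gen eqxx. Qed.

(** Bounds the right divisors by the letters of a representative, so that a largest one can be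
    picked among finitely many. *)
Lemma rdiv_mem a w : rdiv a w -> a \in (repr w : seq E).
Proof.
rewrite /rdiv; elim: (repr w : seq E) => //= b u IH.
rewrite in_cons; case: (rdel a u) IH => [v|_] /=; first by move=> ->; rewrite ?orbT.
by case: eqVneq.
Qed.

(** Letters are peeled off the right end of [s]: a divisor outside [s] has to commute with each of
    them before it reaches [w]. *)
Lemma rdiv_mul_word a w s : a \notin s -> rdiv a (w * word I s)%g ->
  all (I a) s /\ rdiv a w.
Proof.
elim/last_ind: s w => [|s b IH] w; first by rewrite word_nil mulg1.
rewrite mem_rcons in_cons negb_or eq_sym => /andP[ba as_].
rewrite -cats1 word_cat mulgA rdiv_mul_gen (negPf ba) cats1 all_rcons.
case ab: (I a b) => //=; case e: (rdiv a _) => [v|] // _.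
by apply: IH => //; rewrite e.
Qed.

Lemma rdiv_mul_clique a w s : pairwise I s -> a \in s -> rdiv a (w * word I s)%g.
Proof.
elim/last_ind: s w => [//|s b IH] w; rewrite pairwise_rcons => /andP[sb sP].
rewrite mem_rcons in_cons -cats1 word_cat mulgA rdiv_mul_gen eq_sym.
case: eqVneq => [//|ab /= as_]; rewrite (allP sb) //.
by case: (rdiv a _) (IH w sP as_).
Qed.

Lemma trace_cong_size u v : trace_cong I u v -> size u = size v.
Proof. by elim=> [//|//|x y z _ -> _ -> //|x y b c _]; rewrite !size_cat. Qed.

Definition tlength w : nat := size (repr w : seq E).

Lemma tlength_word u : tlength (word I u) = size u.
Proof. by apply: trace_cong_size; apply/wordP; rewrite /word reprK. Qed.

Lemma tlengthM w (v : fpcm I) : tlength (w * v)%g = (tlength w + tlength v)%N.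
Proof.
have [[u ->] [t ->]] := (word_surj w, word_surj v).
by rewrite -word_cat !tlength_word size_cat.
Qed.

End RightDivision.

(** * The largest right divisor of a trace *)

Section TopDivisor.
Variables (d : Order.disp_t) (E : orderType d) (I : rel E).
Hypotheses (I_sym : symmetric I) (I_irr : irreflexive I).
Implicit Types (a b : E) (w : fpcm I).

Definition top_letter w : option E :=
  ohead (sort >=%O [seq a <- repr w | rdiv a w : bool]).

Lemma top_letterP w a : rdiv a w ->
  exists m, [/\ top_letter w = Some m, rdiv m w & forall b, rdiv b w -> (b <= m)%O].
Proof.
move=> aw; rewrite /top_letter.
set t := [seq _ <- _ | _].
have tP b : (b \in sort >=%O t) = rdiv b w.
  rewrite mem_sort mem_filter andb_idr //; exact: rdiv_mem.
have : a \in sort >=%O t by rewrite tP.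
have := @sort_sorted _ (>=%O : rel E) (fun x y => le_total y x) t.
case: (sort _ t) tP => [//|m s] tP ms _; exists m; split=> // [|b].
  by rewrite -tP mem_head.
rewrite -tP in_cons => /predU1P[->//|bs].
by have /= := order_path_min (rev_trans le_trans) ms => /allP; apply.
Qed.

End TopDivisor.

(** * Acyclicity of free functors *)

Lemma del_rcons (T : Type) i (s : seq T) b : (i < size s)%N ->
  del i (rcons s b) = rcons (del i s) b.
Proof.
by move=> si; rewrite /del drop_rcons // -cats1 takel_cat 1?ltnW // rcons_cat.
Qed.

Lemma del_size_rcons (T : Type) (s : seq T) b : del (size s) (rcons s b) = s.
Proof.
rewrite /del -cats1 take_size_cat // drop_oversize ?cats0 //.
by rewrite size_cat addn1.
Qed.

(** A letter of a clique can be moved to its front. *)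
Lemma word_del (E : choiceType) (I : rel E) x i (s : seq E) :
  pairwise I s -> (i < size s)%N ->
  (gen I (nth x s i) * word I (del i s))%g = word I s.
Proof.
elim: i s => [|i IH] [|a s] //= /andP[/allP sa sI] si.
  by rewrite /del /= drop0 word_cons.
rewrite -[del _ _]/(a :: del i s) !word_cons mulgA -genC ?sa ?mem_nth //.
by rewrite -mulgA IH.
Qed.

Section FreeCubicalChains.
Variables (d : Order.disp_t) (E : orderType d) (I : rel E).
Variables (X : right_mset (fpcm I)) (F : ab_functor (mset_cat X)).
Hypotheses (I_sym : symmetric I) (I_irr : irreflexive I).

Local Notation chain := (Q_chain (free_cover F)).
Local Notation bdF := (Q_bd (free_cover F)).

(** Cliques are kept as plain sequences, so that deleting and appending letters needs no casts
    between tuple types. *)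
Definition is_clique n (s : seq E) := (size s == n) && pairwise (ltI I) s.

Lemma is_clique_size n s : is_clique n s -> size s == n.
Proof. by case/andP. Qed.

Lemma is_clique_ltI n s (h : is_clique n s) :
  pairwise (ltI I) (Tuple (is_clique_size h)).
Proof. by have /andP[] := h. Qed.

Lemma Qgens_clique n (q : Qcell X n) : is_clique n (Qgens q).
Proof. by rewrite /is_clique size_tuple eqxx Qgens_ltI. Qed.

Lemma is_clique_del n s i : is_clique n.+1 s -> (i < n.+1)%N -> is_clique n (del i s).
Proof.
move=> /andP[/eqP ss sI] lin; rewrite /is_clique size_del ss ?eqxx //=.
by have [m ->] := del_mask i s; exact: pairwise_mask.
Qed.

Lemma is_clique_I n s : is_clique n s -> pairwise I s.
Proof. by case/andP => _; apply: sub_pairwise => a b; exact: ltI_I. Qed.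

(* The generator (x mu, s) of the summand of Q_n spanned by the generator y in
   F x of the free functor; it is 0 when s is not an increasing n-clique. *)
Definition fcell n (x : X) (y : F x) (mu : fpcm I) (s : seq E) : chain n :=
  if pselect (is_clique n s) is left h then
    @Q_gen _ _ _ _ (free_cover F) n (QCell (mact x mu) (is_clique_ltI h))
      (@fbase _ F (mact x mu) (existT _ x (y, mact_hom x mu)) 1)
  else 0.

Lemma fcell_notin n (x : X) (y : F x) mu s : ~~ is_clique n s -> fcell n y mu s = 0.
Proof. by rewrite /fcell; case: pselect => // h; rewrite h. Qed.

(** Disposes once and for all of the proofs carried by cells and arrows. *)
Lemma fcell_mact n (x : X) (y : F x) mu s (q : Qcell X n)
    (e : mact x mu = Qpt q) : Qgens q = s :> seq E ->
  @Q_gen _ _ _ _ (free_cover F) n q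
    (@fbase _ F (Qpt q) (existT _ x (y, exist _ mu e)) 1) =
  fcell n y mu s.
Proof.
case: q e => x' t tI /= e <-; subst x'.
rewrite /fcell; case: pselect => [h|]; last first.
  by case; exact: (Qgens_clique (QCell (mact x mu) tI)).
have et : Tuple (is_clique_size h) = t by exact: val_inj.
move: (is_clique_ltI h); rewrite et => tI'.
by rewrite (bool_irrelevance tI' tI).
Qed.

Lemma Q_gen_fbase n (q : Qcell X n) (p : fgen F (Qpt q)) z :
  @Q_gen _ _ _ _ (free_cover F) n q (@fbase _ F _ p z) =
  fcell n (projT2 p).1 (sval (projT2 p).2) (Qgens q) *~ z.
Proof.
have -> : @fbase _ F _ p z = @fbase _ F _ p 1 *~ z by rewrite -raddfMz intz.
rewrite /Q_gen raddfMz; congr (_ *~ z).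
by case: p => c [y [mu e]]; exact: fcell_mact.
Qed.

(** The first sum keeps the product [mu * word I s], by [word_del]; the second loses one letter of
    it. *)
Lemma Q_bd_fcell x0 n (x : X) (y : F x) mu s : is_clique n.+1 s ->
  bdF n (fcell n.+1 y mu s) =
  \sum_(i < n.+1) fcell n y (mu * gen I (nth x0 s i))%g (del i s) *~ (-1) ^+ i.+1
  - \sum_(i < n.+1) fcell n y mu (del i s) *~ (-1) ^+ i.+1.
Proof.
move=> sc; have [q qE] : exists q : Qcell X n.+1,
    Qpt q = mact x mu /\ Qgens q = s :> seq E.
  by exists (QCell (mact x mu) (is_clique_ltI sc)).
case: qE => /esym e qs; rewrite -(fcell_mact y e qs) Q_bdE.
rewrite -sumrB; apply: eq_bigr => i _; rewrite -mulrzBl; congr ((_ - _) *~ _).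
  rewrite [afmap _ _ _]free_mapE (tnth_nth x0) qs.
  by apply: fcell_mact; rewrite /= qs.
by apply: fcell_mact; rewrite /= qs.
Qed.

Section Extension.
Variables (A : zmodType) (phi : forall x, F x -> fpcm I -> seq E -> A).

Definition fcell_ext n : {additive chain n -> A} :=
  dsum_elim (fun q : Qcell X n =>
    dsum_elim (fun p : fgen F (Qpt q) =>
      (zmul (phi (projT2 p).1 (sval (projT2 p).2) (Qgens q)) : {additive int -> A}))).

Lemma fcell_extE n (x : X) (y : F x) mu s : is_clique n s ->
  fcell_ext n (fcell n y mu s) = phi y mu s.
Proof.
move=> sc; rewrite /fcell; case: pselect => // h; rewrite [LHS]dsum_elim_inj.
by rewrite [LHS]dsum_elim_inj /= /zmul.
Qed.

End Extension.

(** Differences and zero already produce all integer multiples of a cell, negative ones included. *)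
Lemma fcell_ind n (P : chain n -> Prop) :
  (forall u v, P u -> P v -> P (u - v)) ->
  (forall x (y : F x) mu s, is_clique n s -> P (fcell n y mu s)) ->
  P 0 -> forall u, P u.
Proof.
move=> PB Pgen P0.
have PD u v : P u -> P v -> P (u + v).
  by move=> Pu Pv; rewrite -[v]opprK; apply: (PB) => //; rewrite -[- v]sub0r; exact: (PB).
apply: dsum_ind => // q.
apply: dsum_ind => [|p z|u v Pu Pv]; first by rewrite raddf0.
  have PMn k : P (fcell n (projT2 p).1 (sval (projT2 p).2) (Qgens q) *+ k).
    elim: k => [|k IH]; first by rewrite mulr0n.
    by rewrite mulrS; apply: (PD) => //; exact/Pgen/Qgens_clique.
  have := Q_gen_fbase (q := q) p z; rewrite /Q_gen /= => ->.
  case: z => k; first exact: PMn.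
  by rewrite NegzE mulrNz -[- _]sub0r; apply: (PB) => //; exact: PMn.
by rewrite raddfD; exact: (PD).
Qed.

(** The cone: the top letter [m] passes from the end of [mu] to the end of the clique. The sign is
    the one with which the differential deletes this last letter, so that this face gives back the
    original cell. *)
Definition contract_fcell n x (y : F x) (mu : fpcm I) (s : seq E) : chain n.+1 :=
  if top_letter (mu * word I s)%g is Some m then
    if m \in s then 0
    else if rdiv m mu is Some nu then fcell n.+1 y nu (rcons s m) *~ (-1) ^+ n.+1
    else 0
  else 0.

Definition contract n : {additive chain n -> chain n.+1} :=
  fcell_ext (@contract_fcell n) n.

(** The filtration by the length of [mu * word I s], as an inductive predicate: estimates on cells
    extend to chains by induction, without choosing a decomposition. *)
Inductive length_le n (l : nat) : chain n -> Prop :=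
| length_le0 : length_le l 0
| length_le_fcell (x : X) (y : F x) mu s :
    (tlength mu + n <= l)%N -> length_le l (fcell n y mu s)
| length_leB u v : length_le l u -> length_le l v -> length_le l (u - v).

Lemma length_leN n l (u : chain n) : length_le l u -> length_le l (- u).
Proof. by move=> ul; rewrite -sub0r; apply: length_leB => //; exact: length_le0. Qed.

Lemma length_leD n l (u v : chain n) :
  length_le l u -> length_le l v -> length_le l (u + v).
Proof. by move=> ul vl; rewrite -[v]opprK; apply/length_leB/length_leN. Qed.

Lemma length_le_sign n l k (u : chain n) : length_le l u -> length_le l (u *~ (-1) ^+ k).
Proof.
move=> ul; elim: k => [|k IH]; first by rewrite expr0.
by rewrite exprS mulN1r mulrNz; exact: length_leN.
Qed.

Lemma length_le_sum n l k (f : 'I_k -> chain n) :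
  (forall i, length_le l (f i)) -> length_le l (\sum_i f i).
Proof.
move=> fl; apply: big_ind => // [|u v]; first exact: length_le0.
exact: length_leD.
Qed.

Lemma length_leW n l l' (u : chain n) : (l <= l')%N -> length_le l u -> length_le l' u.
Proof.
move=> ll; elim=> [|x y mu s le|v w _ IH1 _ IH2]; first exact: length_le0.
  by apply: length_le_fcell; exact: leq_trans ll.
exact: length_leB.
Qed.

Lemma length_le_exists n (u : chain n) : exists l, length_le l u.
Proof.
move: u; apply: fcell_ind => [u v [l ul] [k vk]|x y mu s _|].
- exists (maxn l k); apply: length_leB.
    exact: length_leW (leq_maxl _ _) ul.
  exact: length_leW (leq_maxr _ _) vk.
- by exists (tlength mu + n)%N; exact: length_le_fcell.
- by exists 0; exact: length_le0.
Qed.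

(** A positive degree forces a positive length. This is the base of the induction that proves
    acyclicity. *)
Lemma length_le_eq0 n (u : chain n.+1) : length_le 0 u -> u = 0.
Proof.
elim=> [//|x y mu s|v w _ -> _ ->]; last by rewrite subrr.
by rewrite addnS.
Qed.

Lemma rdiv_tlength a (mu nu : fpcm I) :
  rdiv a mu = Some nu -> tlength mu = (tlength nu).+1.
Proof. by move=> /(rdivK I_sym I_irr)->; rewrite tlengthM tlength_word addn1. Qed.

Lemma length_le_contract n x (y : F x) mu s :
  is_clique n s -> length_le (tlength mu + n) (contract n (fcell n y mu s)).
Proof.
move=> sc; rewrite fcell_extE // /contract_fcell.
case: top_letter => [m|]; last exact: length_le0.
case: (m \in s); first exact: length_le0.
case e: (rdiv m mu) => [nu|]; last exact: length_le0.
apply/length_le_sign/length_le_fcell.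
by rewrite (rdiv_tlength e) addnS.
Qed.

(* Up to shorter terms the differential is homogeneous for mu * word s, and on
   the part of weight w <> 1 the chains are those of the simplex on the set of
   right divisors of w, which [contract] cones off at the vertex [top_letter w]. *)
Lemma contract_homotopy n x (y : F x) mu s : is_clique n.+1 s ->
  let u := fcell n.+1 y mu s in
  length_le (tlength mu + n) (u - bdF n.+1 (contract n.+1 u) - contract n (bdF n u)).
Proof.
move=> sc u; have sI := is_clique_I sc.
have ss : size s = n.+1 by apply/eqP; case/andP: sc.
have x0 : E by case: (s) ss.
(* The clique [s] is nonempty and its letters divide the weight, so a top letter exists. *)
have [|m [top mw mmax]] := @top_letterP _ E I (mu * word I s)%g (nth x0 s 0).
  by apply: rdiv_mul_clique => //; apply: mem_nth; rewrite ss.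
have wE i : (i < n.+1)%N ->
    (mu * gen I (nth x0 s i) * word I (del i s))%g = (mu * word I s)%g.
  by move=> ?; rewrite -mulgA word_del // ss.
have dc (i : 'I_n.+1) : is_clique n (del i s) by exact: is_clique_del.
have -> : contract n (bdF n u) =
  \sum_(i < n.+1) contract n (fcell n y (mu * gen I (nth x0 s i))%g (del i s)) *~
    (-1) ^+ i.+1
  - \sum_(i < n.+1) contract n (fcell n y mu (del i s)) *~ (-1) ^+ i.+1.
  rewrite /u (Q_bd_fcell x0) // raddfB !(raddf_sum (contract n)).
  by congr (_ + - _); apply: eq_bigr => i _; rewrite raddfMz.
(* The shortening half of [bdF n u] has cones that are short enough already; only the half that
   keeps the weight remains. *)
rewrite opprB addrCA; apply: length_leD.
  by apply: length_le_sum => i; apply/length_le_sign/length_le_contract.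
have signK k (A : zmodType) (v : A) : v *~ (-1) ^+ k *~ (-1) ^+ k = v.
  by rewrite -mulrzA -expr2 sqrr_sign.
under eq_bigr do rewrite fcell_extE //.
(* If [m] lies in [s] it is the last letter, being the largest. Then [u] and the faces that contain
   [m] have zero cone, while the face without [m] has cone [u], up to the sign that cancels. *)
have [ms|ms] := boolP (m \in s).
  have -> : contract n.+1 u = 0 by rewrite fcell_extE // /contract_fcell top ms.
  have [s' es] : exists s', s = rcons s' m.
    case/lastP: (s) (sc) (ms) (mmax) (sI) ss => // s' b /andP[_ s'lt] ms' mmax' s'I _.
    have bm : (b <= m)%O.
      by apply/mmax'/rdiv_mul_clique; rewrite // mem_rcons mem_head.
    move: s'lt; rewrite pairwise_rcons => /andP[/allP s'b _].
    exists s'; move: ms'; rewrite mem_rcons in_cons => /predU1P[->//|/s'b /andP[mb _]].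
    by have := lt_le_trans mb bm; rewrite ltxx.
  have ss' : size s' = n by move: ss; rewrite es size_rcons => -[].
  have ms' : m \notin s'.
    apply/negP => ms'; move: sc; rewrite es => /andP[_].
    by rewrite pairwise_rcons => /andP[/allP/(_ _ ms')/andP[]]; rewrite ltxx.
  rewrite raddf0 subr0 big_ord_recr /= big1 => [|i _]; last first.
    rewrite /contract_fcell wE 1?leqW // top.
    by rewrite es del_rcons ?ss' // mem_rcons mem_head mul0rz.
  rewrite /contract_fcell wE // top es nth_rcons ss' ltnn eqxx.
  have -> : del n (rcons s' m) = s' by rewrite -ss' del_size_rcons.
  rewrite (negPf ms') rdiv_mulK // add0r signK.
  by rewrite -es subrr; exact: length_le0.
(* Otherwise [m] commutes with [s] and divides [mu]. The half of the boundary of the cone that keeps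
   the weight is [u] minus the cones of the faces, and the shortening half is what is left over. *)
have [ms_I] := rdiv_mul_word I_sym I_irr ms mw.
case e: (rdiv m mu) => [nu|] // _.
have smc : is_clique n.+2 (rcons s m).
  rewrite /is_clique size_rcons ss eqxx pairwise_rcons; case/andP: sc => _ -> /=.
  rewrite andbT; apply/allP => a as_; rewrite /ltI I_sym (allP ms_I) // andbT.
  rewrite lt_neqAle mmax ?rdiv_mul_clique // andbT.
  by apply: contraNneq ms => <-.
have -> : contract n.+1 u = fcell n.+2 y nu (rcons s m) *~ (-1) ^+ n.+2.
  by rewrite fcell_extE // /contract_fcell top (negPf ms) e.
rewrite raddfMz (Q_bd_fcell x0) //.
rewrite mulrzBl.
set T := \sum_(i < n.+1)
  fcell n.+1 y (nu * gen I (nth x0 s i))%g (rcons (del i s) m) *~ (-1) ^+ i.+1.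
have -> : \sum_(i < n.+2) fcell n.+1 y (nu * gen I (nth x0 (rcons s m) i))%g
    (del i (rcons s m)) *~ (-1) ^+ i.+1 = T + u *~ (-1) ^+ n.+2.
  rewrite big_ord_recr /= nth_rcons ss ltnn eqxx.
  have -> : del n.+1 (rcons s m) = s by rewrite -ss del_size_rcons.
  rewrite -(rdivK I_sym I_irr e); congr (_ + _); apply: eq_bigr => i _.
  by rewrite nth_rcons del_rcons ss ltn_ord.
have -> : \sum_(i < n.+1) contract_fcell n y (mu * gen I (nth x0 s i))%g (del i s) *~
    (-1) ^+ i.+1 = T *~ (-1) ^+ n.+1.
  rewrite mulrz_suml; apply: eq_bigr => i _; rewrite /contract_fcell wE // top.
  rewrite ifN; last by have [t ->] := del_mask i s; apply: contra ms; exact: mem_mask.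
  have si : nth x0 s i \in s by rewrite mem_nth ?ss.
  rewrite rdiv_mul_gen // e ifN ?(allP ms_I) //; last by apply: contraNneq ms => <-.
  by rewrite /= -!mulrzA mulrC.
have -> : (T + u *~ (-1) ^+ n.+2) *~ (-1) ^+ n.+2 = u - T *~ (-1) ^+ n.+1.
  by rewrite mulrzDl signK addrC; congr (_ + _); rewrite exprS mulN1r mulrNz.
have subK4 (A : zmodType) (u1 t s1 : A) : u1 - (u1 - t - s1) - t = s1.
  by rewrite opprB addrCA opprB [u1 + _]addrC subrK addrK.
rewrite subK4; apply/length_le_sign/length_le_sum => i.
by apply/length_le_sign/length_le_fcell; rewrite (rdiv_tlength e) addnS.
Qed.

(** Subtracting from a cycle the boundary of its cone gives a cycle of smaller length, because the
    other term of the homotopy vanishes on cycles. *)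
Lemma free_cover_acyclic n (z : chain n.+1) : bdF n z = 0 ->
  exists y, bdF n.+1 y = z.
Proof.
have [l zl] := length_le_exists z.
elim: l z zl => [|l IH] z zl z0; first by exists 0; rewrite raddf0 (length_le_eq0 zl).
have [||y yE] := IH (z - bdF n.+1 (contract n.+1 z)).
(* The estimate is known on cells and [g] is additive. The induction forgets that [z] is a cycle,
   since its pieces need not be cycles. *)
- pose g (u : chain n.+1) := u - bdF n.+1 (contract n.+1 u) - contract n (bdF n u).
  have gB u v : g (u - v) = g u - g v.
    rewrite /g (raddfB (contract _)) (raddfB (bdF n)) (raddfB (bdF _)).
    rewrite (raddfB (contract n)) !opprD [X in X + _ = _]addrACA.
    exact: (addrACA (u - bdF n.+1 (contract n.+1 u))).
  have g0 : g 0 = 0 by rewrite -[X in g X](subrr 0) gB subrr.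
  have : length_le l (g z).
    elim: zl {z0} => [|x y mu s le|v w _ IH1 _ IH2].
    + by rewrite g0; exact: length_le0.
    + have [sc|sc] := boolP (is_clique n.+1 s).
        by apply: length_leW (contract_homotopy _ _ sc); rewrite -ltnS -addnS.
      by rewrite fcell_notin // g0; exact: length_le0.
    + by rewrite gB; exact: length_leB.
  by rewrite /g z0 raddf0 subr0.
- by rewrite raddfB z0 Q_bd_bd subrr.
by exists (y + contract n.+1 z); rewrite raddfD yE subrK.
Qed.

End FreeCubicalChains.

(** * Exactness of the cubical chains *)

Section DsumMap.
Variables (J : Type) (A B : J -> zmodType).

Definition dsum_map (f : forall j, {additive A j -> B j}) :
    {additive dsum A -> dsum B} :=
  dsum_elim (fun j => (@dinj J B j \o f j : {additive A j -> dsum B})).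

Lemma dsum_map_inj (f : forall j, {additive A j -> B j}) j (x : A j) :
  dsum_map f (dinj x) = dinj (f j x).
Proof. exact: dsum_elim_inj. Qed.

Lemma dsum_mapE (f : forall j, {additive A j -> B j}) (u : dsum A) j :
  dsum_map f u j = f j (u j).
Proof.
apply: (dsum_additive_eq (h := dsum_eval B j \o dsum_map f)
  (k := f j \o dsum_eval A j)) => k x.
rewrite -[LHS]/(dsum_map f (dinj x) j) dsum_map_inj.
rewrite -[RHS]/(f j (dinj x j)).
have [<-|kj] := pselect (k = j); first by rewrite /= !dinj_id.
by rewrite /= !dinj_neq // raddf0.
Qed.

Lemma dsum_map_lift (f : forall j, {additive A j -> B j}) (v : dsum B) :
  (forall j, exists x, f j x = v j) -> exists u, dsum_map f u = v.
Proof.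
move=> ex.
(* Lifting zero to zero keeps the support of [u] inside that of [v], hence finite. *)
have /choice_dep[u uP] j : exists x, f j x = v j /\ (v j = 0 -> x = 0).
  have [vj|vj] := pselect (v j = 0); first by exists 0; rewrite raddf0 vj.
  by have [x fx] := ex j; exists x.
have ufin : finite_set [set j | u j != 0]%classic.
  apply: sub_finite_set (dsum_fin v) => j /=; apply: contra_neq.
  exact: (uP j).2.
by exists (DSum ufin); apply: dsumP => j; rewrite dsum_mapE (uP j).1.
Qed.

End DsumMap.

Lemma dsum_map_exact (J : Type) (A B C : J -> zmodType)
    (f : forall j, {additive A j -> B j}) (g : forall j, {additive B j -> C j}) :
  (forall j x, g j x = 0 <-> exists y, f j y = x) ->
  forall u, dsum_map g u = 0 <-> exists v, dsum_map f v = u.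
Proof.
move=> fg u; split=> [gu|[v <-]].
  by apply: dsum_map_lift => j; apply/fg; rewrite -dsum_mapE gu.
by apply: dsumP => j; rewrite !dsum_mapE; apply/fg; exists (v j).
Qed.

Definition nt_id (C : category) (F : ab_functor C) : nat_trans F F :=
  @NatTrans C F F (fun c => idfun) (fun _ _ _ _ => erefl).

Section CubicalChains.
Variables (d : Order.disp_t) (E : orderType d) (I : rel E).
Variable X : right_mset (fpcm I).
Implicit Types F G P : ab_functor (mset_cat X).

Definition Q_map F G (eta : nat_trans F G) n : {additive Q_chain F n -> Q_chain G n} :=
  dsum_map (fun q : Qcell X n => eta (Qpt q)).

Lemma Q_map_gen F G (eta : nat_trans F G) n (q : Qcell X n) (g : F (Qpt q)) :
  Q_map eta n (Q_gen g) = Q_gen (eta (Qpt q) g).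
Proof. exact: dsum_map_inj. Qed.

Lemma Q_map_bd F G (eta : nat_trans F G) n (u : Q_chain F n.+1) :
  Q_map eta n (Q_bd F n u) = Q_bd G n (Q_map eta n.+1 u).
Proof.
apply: (dsum_additive_eq (h := Q_map eta n \o Q_bd F n)
  (k := Q_bd G n \o Q_map eta n.+1)) => q g.
rewrite -[LHS]/(Q_map eta n (Q_bd F n (Q_gen g))).
rewrite -[RHS]/(Q_bd G n (Q_map eta n.+1 (Q_gen g))) Q_map_gen !Q_bdE.
rewrite raddf_sum; apply: eq_bigr => s _.
by rewrite raddfMz (raddfB (Q_map eta n)) /= !Q_map_gen nt_nat.
Qed.

(** Projectivity splits the free cover: a cycle is sent into the free complex by the section,
    bounded there, and the bounding chain is sent back. *)
Lemma projective_acyclic P n (z : Q_chain P n.+1) :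
  symmetric I -> irreflexive I -> projective P ->
  Q_bd P n z = 0 <-> exists y, Q_bd P n.+1 y = z.
Proof.
move=> I_sym I_irr P_proj; split=> [z0|[y <-]]; last exact: Q_bd_bd.
have [psi psiP] := P_proj _ _ _ (@free_aug_surj _ P) (nt_id P).
have [|y yE] := @free_cover_acyclic _ _ _ _ P I_sym I_irr n (Q_map psi _ z).
  by rewrite -Q_map_bd z0 raddf0.
exists (Q_map (free_aug P) _ y); rewrite -Q_map_bd yE.
by apply: dsumP => q; rewrite !dsum_mapE psiP.
Qed.

(** * The colimit as cubical homology in degree zero *)

Section Augmentation.
Variable F : ab_functor (mset_cat X).

Definition vertex (x : X) : Qcell X 0 := @QCell _ _ _ _ 0 x [tuple] isT.

Lemma Q_gen_vertex (q : Qcell X 0) (g : F (Qpt q)) :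
  Q_gen g = @Q_gen _ _ _ _ F 0 (vertex (Qpt q)) g.
Proof.
case: q g => x s sI /= g; move: sI; rewrite (tuple0 s) => sI.
by rewrite /vertex (bool_irrelevance sI isT).
Qed.

Definition Q0_dsum : {additive Q_chain F 0 -> dsum F} :=
  dsum_elim (fun q : Qcell X 0 => (@dinj _ F (Qpt q) : {additive _ -> _})).

Definition dsum_Q0 : {additive dsum F -> Q_chain F 0} :=
  dsum_elim (fun x : X =>
    mk_additive (@dinj_is_additive _ (fun q : Qcell X 0 => F (Qpt q)) (vertex x))).

Lemma Q0_dsumK : cancel Q0_dsum dsum_Q0.
Proof.
apply: (dsum_additive_eq (h := dsum_Q0 \o Q0_dsum) (k := idfun)) => q g.
rewrite -[LHS]/(dsum_Q0 (Q0_dsum (Q_gen g))).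
rewrite [Q0_dsum _]dsum_elim_inj [LHS]dsum_elim_inj.
exact: esym (Q_gen_vertex g).
Qed.

Lemma dsum_Q0K : cancel dsum_Q0 Q0_dsum.
Proof.
apply: (dsum_additive_eq (h := Q0_dsum \o dsum_Q0) (k := idfun)) => x g.
rewrite -[LHS]/(Q0_dsum (dsum_Q0 (@dinj _ F x g))).
by rewrite [dsum_Q0 _]dsum_elim_inj [LHS]dsum_elim_inj.
Qed.

Definition colim_aug : {additive Q_chain F 0 -> colim F} :=
  coker_pi (colim_rel F) \o Q0_dsum.

Lemma colim_aug_surj y : exists u, colim_aug u = y.
Proof.
by have [w <-] := coker_pi_surj y; exists (dsum_Q0 w); rewrite /= dsum_Q0K.
Qed.

Definition edge (x : X) (a : E) : Qcell X 1 := @QCell _ _ _ _ 1 x [tuple a] isT.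

Lemma Q_bd_edge x a (g : F x) :
  Q_bd F 0 (@Q_gen _ _ _ _ F 1 (edge x a) g) =
  @Q_gen _ _ _ _ F 0 (vertex x) g -
  @Q_gen _ _ _ _ F 0 (vertex (mact x (gen I a))) (afmap F (mact_hom x (gen I a)) g).
Proof.
rewrite Q_bdE /Q_bd_gen big_ord1 expr1 mulrN1z opprB /=.
by congr (_ - _); exact: Q_gen_vertex.
Qed.

(** A telescoping sum of edges along the letters of [s]. *)
Lemma Q_bd_path x (g : F x) (s : seq E) (y : X) (e : mact x (word I s) = y) :
  exists v, Q_bd F 0 v = @Q_gen _ _ _ _ F 0 (vertex x) g -
    @Q_gen _ _ _ _ F 0 (vertex y)
      (afmap F (exist _ (word I s) e : @Defs.hom (mset_cat X) x y) g).
Proof.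
elim: s x g y e => [|a s IH] x g y e.
  exists 0; rewrite raddf0; symmetry; apply/eqP; rewrite subr_eq0; apply/eqP.
  rewrite -[g in LHS](@afmap1 _ F).
  by apply: Q_gen_eq => //; rewrite -e word_nil mact1.
have e' : mact (mact x (gen I a)) (word I s) = y by rewrite -mactM -word_cons.
have [v vE] := IH _ (afmap F (mact_hom x (gen I a)) g) _ e'.
exists (@Q_gen _ _ _ _ F 1 (edge x a) g + v).
rewrite raddfD Q_bd_edge vE addrA subrK -afmapM; congr (_ - _).
by apply: Q_gen_eq => //=; rewrite word_cons.
Qed.

(** The colimit has a relation for every trace, the cubical complex only for single letters;
    [Q_bd_path] bridges the gap. Conversely, each edge is an arrow of the category. *)
Lemma colim_aug_exact (u : Q_chain F 0) :
  colim_aug u = 0 <-> exists v, Q_bd F 0 v = u.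
Proof.
split=> [|[v <-]].
  move=> /= u0; have /coker_piP[w] : coker_pi (colim_rel F) (Q0_dsum u) = coker_pi _ 0.
    by rewrite raddf0.
  rewrite subr0 => /(congr1 dsum_Q0); rewrite Q0_dsumK => <- {u u0}.
  elim/dsum_ind: w => [|p g|v w [v' vE] [w' wE]].
  - by exists 0; rewrite !raddf0.
  - rewrite colim_rel_inj /colim_rel_fun raddfB.
    rewrite ![dsum_Q0 _]dsum_elim_inj.
    case: p g => -[x y] [mu e] /= g; have [s es] := word_surj mu; subst mu.
    exact: Q_bd_path.
  - by exists (v' + w'); rewrite !raddfD /= vE wE.
apply: (dsum_additive_eq (h := colim_aug \o Q_bd F 0) (k := \0)) => q g.
rewrite -[LHS]/(colim_aug (Q_bd F 0 (Q_gen g))) Q_bdE /Q_bd_gen big_ord1.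
rewrite expr1 mulrN1z opprB raddfB /=.
apply/eqP; rewrite subr_eq0; apply/eqP/coker_piP.
rewrite ![Q0_dsum _]dsum_elim_inj.
pose a := gen I (tnth (Qgens q) ord0).
pose p : arrow (mset_cat X) :=
  existT (fun ab : mset_cat X * mset_cat X => Defs.hom ab.1 ab.2)
    (Qpt q, mact (Qpt q) a) (mact_hom (Qpt q) a).
exists (@dinj _ (fun p : arrow (mset_cat X) => F (projT1 p).1) p g).
by rewrite colim_rel_inj.
Qed.

End Augmentation.

Lemma colim_aug_map F G (eta : nat_trans F G) (u : Q_chain F 0) :
  colim_aug G (Q_map eta 0 u) = colim_map eta (colim_aug F u).
Proof.
rewrite -[colim_aug F u]/(coker_pi (colim_rel F) (Q0_dsum F u)) colim_mapE.
congr (coker_pi (colim_rel G)).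
apply: (dsum_additive_eq (h := Q0_dsum G \o Q_map eta 0)
  (k := dsum_nt eta \o Q0_dsum F)) => q g.
rewrite -[LHS]/(Q0_dsum G (Q_map eta 0 (Q_gen g))) Q_map_gen.
rewrite -[RHS]/(dsum_nt eta (Q0_dsum F (Q_gen g))) [Q0_dsum F _]dsum_elim_inj.
by rewrite [LHS]dsum_elim_inj dsum_nt_inj.
Qed.

End CubicalChains.

(** * Derived colimits and cubical homology *)

Theorem theorem3p3 (d : Order.disp_t) (E : orderType d) (I : rel E)
    (I_sym : symmetric I) (I_irr : irreflexive I)
    (I_lfd : locally_finite_dimensional I)
    (X : right_mset (fpcm I)) (F : ab_functor (mset_cat X))
    (P : projective_resolution F) :
  (forall n : nat,
     zmod_iso (derived_colim P n) (semicubical_homology (Fbar F) n)) /\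
  (forall n : nat,
     zmod_iso (derived_colim P n) (homology (Q_complex F) n)).
Proof.
(* Here [p] is the cubical degree and [q] the degree in the resolution. *)
have res : @double_resolution (fun p q => Q_chain (P q) p)
    (colim_complex P) (Q_complex F) (fun p q => Q_bd (P q) p)
    (fun p q => Q_map (pr_bd P q) p) (fun q => colim_aug (P q))
    (fun p => Q_map (pr_aug P) p).
  split.
  - by move=> p q x; rewrite Q_map_bd.
  - by move=> q x; rewrite colim_aug_map.
  - by move=> p x; rewrite Q_map_bd.
  - by move=> q a; exact: colim_aug_surj.
  - by move=> q x; exact: colim_aug_exact.
  - by move=> p q x; apply: projective_acyclic => //; exact: pr_projective.
  - by move=> p b; apply: dsum_map_lift => q; exact: pr_aug_surj.
  - by move=> p; apply: dsum_map_exact => q; exact: pr_exact0.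
  - by move=> p q; apply: dsum_map_exact => c; exact: pr_exactS.
split=> n; last exact: double_resolution_homology res.
(* Both complexes have the same groups, and their differentials agree by [Q_bd_sc]; only the
   compatibility of the second augmentation with the differential has to be restated. *)
apply: (@double_resolution_homology (fun p q => Q_chain (P q) p)
  (colim_complex P) (semicubical_complex (Fbar F)) (fun p q => Q_bd (P q) p)
  (fun p q => Q_map (pr_bd P q) p) (fun q => colim_aug (P q))
  (fun p => Q_map (pr_aug P) p)).
case: res => r1 r2 r3 *; split=> // p x.
exact: etrans (r3 p x) (Q_bd_sc _).
Qed.
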